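(* Let $k\ge d\ge1$ and let $\alpha\in\Pi(k,d)$. Then \[\begin{aligned}\sum_{\boldsymbol{k}\in\alpha}\sum_{s=0}^{k_1-2}\zeta_{\widehat{\mathcal{Q}}}(k_1-s,k_2,\dots,k_d,s+1)&=\sum_{\boldsymbol{k}\in\alpha}\zeta_{\widehat{\mathcal{Q}}}(k_1+1,k_2,\dots,k_d)\\&\quad+\sum_{\boldsymbol{k}\in\alpha}\sum_{l\ge0}(q^{-\boldsymbol{p}}[\boldsymbol{p}])^l\Big\{\zeta_{\widehat{\mathcal{Q}}}(k_2,\dots,k_d,k_1,l+1)+\zeta_{\widehat{\mathcal{Q}}}(k_2,\dots,k_d,k_1+l+1)\Big\}\\&\quad+(1-q)\sum_{\boldsymbol{k}\in\alpha}\sum_{l\ge0}(q^{-\boldsymbol{p}}[\boldsymbol{p}])^l\,\zeta_{\widehat{\mathcal{Q}}}(k_2,\dots,k_d,k_1+l)\end{aligned}\] and \[\begin{aligned}\sum_{\boldsymbol{k}\in\alpha}\sum_{s=0}^{k_1-2}\zeta^\star_{\widehat{\mathcal{Q}}}(k_1-s,k_2,\dots,k_d,s+1)&=\frac{k}{d}|\alpha|\,\zeta^\star_{\widehat{\mathcal{Q}}}(k+1)+|\alpha|\sum_{j=1}^d\Big(\frac{k}{j}-1\Big)\binom{d}{j}(1-q)^j\zeta^\star_{\widehat{\mathcal{Q}}}(k+1-j)\\&\quad+\sum_{\boldsymbol{k}\in\alpha}\sum_{l\ge0}(q^{-\boldsymbol{p}}[\boldsymbol{p}])^l\,\zeta^\star_{\widehat{\mathcal{Q}}}(k_2,\dots,k_d,k_1,l+1),\end{aligned}\]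 where in each summand $\boldsymbol{k}=(k_1,\dots,k_d)$ and the inner sum over $s$ is empty when $k_1=1$.
   Context: Cyclic orbits. The cyclic permutation acts on the set of indices (sequences of positive integers) of weight $k$ and depth $d$ by $(k_1,k_2,\dots,k_d)\mapsto(k_2,\dots,k_d,k_1)$. $\Pi(k,d)$ denotes the set of orbits of this action, and $|\alpha|$ denotes the cardinality of an orbit $\alpha$. $q$-sums. Let $[n]=(1-q^n)/(1-q)$ and \[H_m(\boldsymbol{k};q)=\sum_{m\ge m_1>\cdots>m_d>0}\prod_a\frac{q^{(k_a-1)m_a}}{[m_a]^{k_a}},\] with $H^\star_m$ the same sum taken over $m\ge m_1\ge\cdots\ge m_d>0$. The ring $\widehat{\mathcal{Q}}$. For a prime $p$, $\mathbb{Z}_{(p)}$ is the set of rationals whose denominator is prime to $p$, and $Z_{p,n}=\mathbb{Z}_{(p)}[q]/([p]^n)$. Set $\mathcal{Q}_n=(\prod_pZ_{p,n})/(\bigoplus_pZ_{p,n})$ and $\widehat{\mathcal{Q}}=\varprojlim_n\mathcal{Q}_n$, a $\mathbb{Q}[q]$-algebra; here $[m]$ is invertible in $Z_{p,n}$ for $1\le m<p$. Define $\zeta^\bullet_{\widehat{\mathcal{Q}}}(\boldsymbol{k})=((H^\bullet_{p-1}(\boldsymbol{k};q)\bmod[p]^n)_p)_n$ for $\bullet\in\{\emptyset,\star\}$. Put $[\boldsymbol{p}]=(([p]\bmod[p]^n)_p)_n$ and $q^{-\boldsymbol{p}}=(((q^p)^{-1}\bmod[p]^n)_p)_n$ (note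 $q^p=1-(1-q)[p]$ is invertible modulo $[p]^n$). The ring $\widehat{\mathcal{Q}}$ is complete in the $[\boldsymbol{p}]$-adic topology.
   Formalization: In the star identity the coefficient (k/j−1)·binom(d,j) is corrected to (k/j−1)·binom(d−1,j−1); the printed form fails e.g. for k=d=2, α={(1,1)}, where the two differ by (1−q)ζ*(2) ≠ 0; for d=1 they agree. *)

(* Defs.v *)
From HB Require Import structures.
From mathcomp Require Import all_boot all_order all_algebra.
From mathcomp Require Import all_fingroup.
From mathcomp Require Import generic_quotient ring_quotient.
From mathcomp Require Import zify.
From mathcomp Require Import boolp classical_sets functions cardinality.

Set Implicit Arguments.
Unset Strict Implicit.
Unset Printing Implicit Defensive.

Import GRing.Theory Num.Theory.

Local Open Scope ring_scope.

(** * Arbitrary products, inverses and adic sums in commutative rings *)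

Definition dprod (I : Type) (R : I -> Type) := forall i : I, R i.

HB.instance Definition _ (I : Type) (R : I -> choiceType) :=
  Choice.copy (dprod R) (forall i, R i).

Section DependentProduct.
Context (I : pointedType) (R : I -> comNzRingType).
Implicit Types x y z : dprod R.

Lemma dprodP x y : (forall i, x i = y i) -> x = y.
Proof. exact: functional_extensionality_dep. Qed.

Fact dprod_addA : associative (fun x y : dprod R => (fun i => x i + y i) : dprod R).
Proof. by move=> x y z; apply: dprodP => i; rewrite addrA. Qed.
Fact dprod_addC : commutative (fun x y : dprod R => (fun i => x i + y i) : dprod R).
Proof. by move=> x y; apply: dprodP => i; rewrite addrC. Qed.
Fact dprod_add0 : left_id ((fun=> 0) : dprod R) (fun x y => (fun i => x i + y i)).
Proof. by move=> x; apply: dprodP => i; rewrite add0r. Qed.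
Fact dprod_addN : left_inverse ((fun=> 0) : dprod R) (fun x => (fun i => - x i))
  (fun x y => (fun i => x i + y i)).
Proof. by move=> x; apply: dprodP => i; rewrite addNr. Qed.

HB.instance Definition _ := GRing.isZmodule.Build (dprod R)
  dprod_addA dprod_addC dprod_add0 dprod_addN.

Fact dprod_mulA : associative (fun x y : dprod R => (fun i => x i * y i) : dprod R).
Proof. by move=> x y z; apply: dprodP => i; rewrite mulrA. Qed.
Fact dprod_mulC : commutative (fun x y : dprod R => (fun i => x i * y i) : dprod R).
Proof. by move=> x y; apply: dprodP => i; rewrite mulrC. Qed.
Fact dprod_mul1 : left_id ((fun=> 1) : dprod R) (fun x y => (fun i => x i * y i)).
Proof. by move=> x; apply: dprodP => i; rewrite mul1r. Qed.
Fact dprod_mulD : left_distributive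
  (fun x y : dprod R => (fun i => x i * y i) : dprod R) +%R.
Proof. by move=> x y z; apply: dprodP => i; rewrite /= mulrDl. Qed.
Fact dprod_1neq0 : ((fun=> 1) : dprod R) != 0.
Proof.
by apply/eqP => /(congr1 (@^~ point)) /eqP; rewrite (oner_eq0 (R point)).
Qed.

HB.instance Definition _ := GRing.Zmodule_isComNzRing.Build (dprod R)
  dprod_mulA dprod_mulC dprod_mul1 dprod_mulD dprod_1neq0.

Lemma dprodD x y i : (x + y) i = x i + y i. Proof. by []. Qed.
Lemma dprodN x i : (- x) i = - x i. Proof. by []. Qed.
Lemma dprodM x y i : (x * y) i = x i * y i. Proof. by []. Qed.
Lemma dprod0 i : (0 : dprod R) i = 0. Proof. by []. Qed.
Lemma dprod1 i : (1 : dprod R) i = 1. Proof. by []. Qed.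

End DependentProduct.

Section ClassicalInverse.
Context (R : comNzRingType).

Definition cunit : {pred R} := fun x => `[< exists y : R, y * x = 1 >].
Definition cinv (x : R) : R := xget x [set y | y * x = 1].

Fact cmulVx : {in cunit, left_inverse 1 cinv *%R}.
Proof. by move=> x /asboolP xU; rewrite /cinv; case: xgetP => // n; case: xU => y /n. Qed.
Fact cunitPl (x y : R) : y * x = 1 -> cunit x.
Proof. by move=> yx1; apply/asboolP; exists y. Qed.
Fact cinv_out : {in [predC cunit], cinv =1 id}.
Proof.
move=> x /asboolP xnU; rewrite /cinv; case: xgetP => // y _ /= yx1.
by case: xnU; exists y.
Qed.
End ClassicalInverse.

Section QuotientMap.
Context (R S : comNzRingType) (I : idealr R) (J : idealr S).
Context (f : {rmorphism R -> S}) (fIJ : forall x : R, x \in I -> f x \in J).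

Definition quot_map (x : {ideal_quot I}) : {ideal_quot J} :=
  (\pi_{ideal_quot J} (f (repr x)))%qT.

Lemma quot_map_pi (x : R) :
  quot_map (\pi_{ideal_quot I} x)%qT = (\pi_{ideal_quot J} (f x))%qT.
Proof.
apply/eqP; rewrite -Quotient.idealrBE -rmorphB fIJ //.
by rewrite Quotient.idealrBE reprK.
Qed.

Fact quot_map_is_zmod_morphism : zmod_morphism quot_map.
Proof.
move=> x y; rewrite -[x]reprK -[y]reprK.
by rewrite -[_ - _](rmorphB (\pi_{ideal_quot I}%qT)) !quot_map_pi !rmorphB.
Qed.

Fact quot_map_is_monoid_morphism : monoid_morphism quot_map.
Proof.
split=> [|x y].
  by rewrite -(rmorph1 (\pi_{ideal_quot I}%qT)) quot_map_pi !rmorph1.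
rewrite -[x]reprK -[y]reprK.
by rewrite -[_ * _](rmorphM (\pi_{ideal_quot I}%qT)) !quot_map_pi !rmorphM.
Qed.
End QuotientMap.

(* [is_adic_sum x a s]: the series of the [a l] converges to [s] in the        *)
(* [x]-adic topology.                                                          *)
Definition is_adic_sum (R : comNzRingType) (x : R) (a : nat -> R) (s : R) : Prop :=
  forall N : nat, exists M : nat, forall m : nat, (M <= m)%N ->
    exists z : R, s - \sum_(l < m) a l = x ^+ N * z.

(* By convention 0 if the series does not converge.                            *)
Definition adic_sum (R : comNzRingType) (x : R) (a : nat -> R) : R :=
  xget 0 [set s | is_adic_sum x a s].

(** * q-integers and q-harmonic sums *)

(* (1 - q^n) / (1 - q), written so as to make sense for all q.                 *)
Definition qint (R : pzSemiRingType) (q : R) (n : nat) : R := \sum_(i < n) q ^+ i.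

(* Sum over the sequences ms of positive integers <= m, of the same depth as   *)
(* ks, whose consecutive entries are related by [rel]. The subtraction in the  *)
(* exponent is truncated, hence junk if ks has a null entry.                   *)
Definition qharm (rel : rel nat) (R : comUnitRingType) (q : R)
    (m : nat) (ks : seq nat) : R :=
  \sum_(ms : (size ks).-tuple 'I_m.+1 |
          sorted rel (map val ms) && all (ltn 0) (map val ms))
    \prod_(a < size ks)
      (q ^+ ((nth 0%N ks a - 1) * tnth ms a)
       / qint q (tnth ms a) ^+ (nth 0%N ks a)).

Definition qH (R : comUnitRingType) (q : R) (m : nat) (ks : seq nat) : R :=
  qharm gtn q m ks.
Definition qHstar (R : comUnitRingType) (q : R) (m : nat) (ks : seq nat) : R :=
  qharm geq q m ks.

(** * The ring Z_(p) *)

Definition zloc_pred (p : nat) : {pred rat} := fun x => coprime p `|denq x|.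

Lemma zloc_predP (p : nat) (x : rat) :
  reflect (exists2 d : int, coprime p `|d| & d != 0 /\ exists n : int, x * d%:~R = n%:~R)
          (x \in zloc_pred p).
Proof.
apply: (iffP idP) => [xp|[d dp [d0 [n xd]]]].
  exists (denq x); first exact: xp.
  by rewrite denq_neq0; split => //; exists (numq x); rewrite -numqE.
have xE : (numq x * d = n * denq x)%R.
  apply/eqP; rewrite -(eqr_int rat) !rmorphM /= numqE -xd.
  by apply/eqP; rewrite -!mulrA [(denq x)%:~R * _]mulrC.
rewrite /zloc_pred unfold_in; apply: coprime_dvdr dp.
have : (denq x %| numq x * d)%Z by rewrite xE dvdz_mull.
by rewrite dvdzE abszM Gauss_dvdr // coprime_sym coprime_num_den.
Qed.

Fact zloc_subring_closed p : subring_closed (zloc_pred p).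
Proof.
split=> [|x y|x y].
- by rewrite unfold_in /zloc_pred /= coprimen1.
- move=> /zloc_predP[d dp [d0 [n xd]]] /zloc_predP[e ep [e0 [m ye]]].
  apply/zloc_predP; exists (d * e); first by rewrite abszM coprimeMr dp.
  split; first by rewrite mulf_neq0.
  exists (n * e - m * d); rewrite rmorphB !rmorphM /= -xd -ye mulrBl !mulrA.
  by rewrite -[y * _ * _]mulrA [d%:~R * e%:~R]mulrC mulrA.
- move=> /zloc_predP[d dp [d0 [n xd]]] /zloc_predP[e ep [e0 [m ye]]].
  apply/zloc_predP; exists (d * e); first by rewrite abszM coprimeMr dp.
  split; first by rewrite mulf_neq0.
  by exists (n * m); rewrite !rmorphM /= -xd -ye mulrACA.
Qed.

HB.instance Definition _ p :=
  GRing.isSubringClosed.Build rat (zloc_pred p) (zloc_subring_closed p).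

Record zloc (p : nat) := Zloc { zloc_val :> rat; _ : zloc_val \in zloc_pred p }.

HB.instance Definition _ p := [isSub of zloc p for @zloc_val p].
HB.instance Definition _ p := [Choice of zloc p by <:].
HB.instance Definition _ p := [SubChoice_isSubComNzRing of zloc p by <:].

(** * The rings Z_{p,n} *)

Record prime_nat := PrimeNat { prime_val :> nat; prime_valP : prime prime_val }.

HB.instance Definition _ := [isSub of prime_nat for prime_val].
HB.instance Definition _ := [Choice of prime_nat by <:].
HB.instance Definition _ := isPointed.Build prime_nat (@PrimeNat 2 isT).

(* The ideal ([p]^(n+1)) of Z_(p)[q].                                          *)
Definition qideal (p : prime_nat) (n : nat) : {pred {poly zloc p}} :=
  fun f => `[< exists r, f = r * qint 'X p ^+ n.+1 >].

Lemma qint_rmorph (R S : pzSemiRingType) (f : {rmorphism R -> S}) q n :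
  f (qint q n) = qint (f q) n.
Proof. by rewrite rmorph_sum; apply: eq_bigr => i _; rewrite rmorphXn. Qed.

Lemma qintX_monic (R : nzRingType) n : (0 < n)%N -> qint ('X : {poly R}) n \is monic.
Proof.
case: n => // n _; have -> : qint ('X : {poly R}) n.+1 = \poly_(i < n.+1) 1.
  by rewrite poly_def; apply: eq_bigr => i _; rewrite scale1r.
by rewrite monicE lead_coef_poly ?oner_eq0.
Qed.

Lemma size_qintX (R : nzRingType) n : size (qint ('X : {poly R}) n) = n.
Proof.
case: n => [|n]; first by rewrite /qint big_ord0 size_poly0.
have -> : qint ('X : {poly R}) n.+1 = \poly_(i < n.+1) 1.
  by rewrite poly_def; apply: eq_bigr => i _; rewrite scale1r.
by rewrite size_poly_eq ?oner_eq0.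
Qed.

Fact qideal_idealr_closed p n : idealr_closed (@qideal p n).
Proof.
split=> [||a x y /asboolP[r ->] /asboolP[s ->]].
- by apply/asboolP; exists 0; rewrite mul0r.
- apply/negP => /asboolP[r r1].
  have p0 := prime_gt0 (prime_valP p).
  have r0 : r != 0 by apply: contra_eq_neq r1 => ->; rewrite mul0r oner_eq0.
  have := congr1 (fun f : {poly _} => size f) r1.
  rewrite size_Mmonic ?monic_exp ?qintX_monic // size_poly1 exprSr.
  rewrite size_Mmonic ?monic_neq0 ?monic_exp ?qintX_monic // size_qintX.
  have : (0 < size (qint ('X : {poly zloc p}) p ^+ n))%N.
    by rewrite size_poly_gt0 monic_neq0 // monic_exp ?qintX_monic.
  move: r0; rewrite -size_poly_gt0.
  case: (size r) => // i _; case: (size _) => // j _.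
  by case: (prime_val p) (prime_gt1 (prime_valP p)) => [|[|l]] //; lia.
- by apply/asboolP; exists (a * r + s); rewrite mulrDl mulrA.
Qed.

HB.instance Definition _ (p : prime_nat) n :=
  isIdealr.Build {poly zloc p} (@qideal p n) (@qideal_idealr_closed p n).

(* [zpn p n] is Z_{p,n+1}: only the zero ring Z_{p,0} is left out, which does  *)
(* not affect the inverse limit below.                                         *)
Definition zpn (p : prime_nat) (n : nat) := {ideal_quot @qideal p n}.

HB.instance Definition _ p n := GRing.ComNzRing.on (zpn p n).
HB.instance Definition _ p n := GRing.ComNzRing_hasMulInverse.Build (zpn p n)
  (@cmulVx (zpn p n)) (@cunitPl (zpn p n)) (@cinv_out (zpn p n)).

Definition to_zpn (p : prime_nat) n (f : {poly zloc p}) : zpn p n :=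
  (\pi_(zpn p n) f)%qT.

Fact to_zpn_is_zmod_morphism p n : zmod_morphism (@to_zpn p n).
Proof. exact: pi_is_zmod_morphism. Qed.
Fact to_zpn_is_monoid_morphism p n : monoid_morphism (@to_zpn p n).
Proof. exact: pi_is_monoid_morphism. Qed.
HB.instance Definition _ (p : prime_nat) n :=
  GRing.isZmodMorphism.Build {poly zloc p} (zpn p n) (@to_zpn p n)
    (@to_zpn_is_zmod_morphism p n).
HB.instance Definition _ (p : prime_nat) n :=
  GRing.isMonoidMorphism.Build {poly zloc p} (zpn p n) (@to_zpn p n)
    (@to_zpn_is_monoid_morphism p n).

Lemma to_zpn_repr p n (x : zpn p n) : to_zpn n (repr x)%qT = x.
Proof. exact: reprK. Qed.

Lemma to_zpnP (p : prime_nat) n (f g : {poly zloc p}) :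
  (to_zpn n f = to_zpn n g) <-> exists r, f - g = r * qint 'X p ^+ n.+1.
Proof.
have -> : (to_zpn n f = to_zpn n g) <-> (f - g \in @qideal p n).
  by rewrite Quotient.idealrBE; split=> /eqP.
by split=> /asboolP.
Qed.

(* The reduction Z_{p,n+2} -> Z_{p,n+1}.                                       *)
Definition redn p n (x : zpn p n.+1) : zpn p n := to_zpn n (repr x)%qT.

Fact sub_qideal (p : prime_nat) n (f : {poly zloc p}) :
  f \in @qideal p n.+1 -> idfun f \in @qideal p n.
Proof.
move=> /asboolP[r ->]; apply/asboolP; exists (r * qint 'X p).
by rewrite [_ ^+ n.+2]exprS mulrA.
Qed.

Lemma redn_to_zpn (p : prime_nat) n f : redn (to_zpn n.+1 f) = to_zpn n f :> zpn p n.
Proof. exact: (quot_map_pi (@sub_qideal p n)). Qed.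

Fact redn_is_zmod_morphism p n : zmod_morphism (@redn p n).
Proof. exact: (quot_map_is_zmod_morphism (@sub_qideal p n)). Qed.
Fact redn_is_monoid_morphism p n : monoid_morphism (@redn p n).
Proof. exact: (quot_map_is_monoid_morphism (@sub_qideal p n)). Qed.
HB.instance Definition _ (p : prime_nat) n :=
  GRing.isZmodMorphism.Build (zpn p n.+1) (zpn p n) (@redn p n)
    (@redn_is_zmod_morphism p n).
HB.instance Definition _ (p : prime_nat) n :=
  GRing.isMonoidMorphism.Build (zpn p n.+1) (zpn p n) (@redn p n)
    (@redn_is_monoid_morphism p n).

Definition zq p n : zpn p n := to_zpn n 'X.

Lemma redn_zq p n : redn (zq p n.+1) = zq p n.
Proof. exact: redn_to_zpn. Qed.

Lemma zp_nilp p n : qint (zq p n) p ^+ n.+1 = 0.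
Proof.
rewrite -[qint _ _](qint_rmorph (@to_zpn p n)) -rmorphXn.
by rewrite -(rmorph0 (@to_zpn p n)); apply/to_zpnP; exists 1; rewrite subr0 mul1r.
Qed.

Lemma nilp_unit (R : comUnitRingType) (x e : R) n : e ^+ n = 0 ->
  x + e \is a GRing.unit -> x \is a GRing.unit.
Proof.
move=> en0 /unitrPr[y xy].
have [z hz] : exists z, (x + e) ^+ n - e ^+ n = x * z.
  rewrite subrXX; exists (\sum_(i < n) (x + e) ^+ (n.-1 - i) * e ^+ i).
  by rewrite addrK.
apply/unitrPr; exists (z * y ^+ n).
by rewrite mulrA -hz en0 subr0 -exprMn xy expr1n.
Qed.

Lemma qintD (R : comNzRingType) (q : R) m n : qint q (m + n) = qint q m + q ^+ m * qint q n.
Proof.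
rewrite /qint big_split_ord /= mulr_sumr; congr (_ + _).
by apply: eq_bigr => i _; rewrite exprD.
Qed.

Lemma qintM (R : comNzRingType) (q : R) m n : qint q (m * n) = qint q m * qint (q ^+ m) n.
Proof.
elim: n => [|n IH]; first by rewrite muln0 /qint !big_ord0 mulr0.
rewrite mulnS addnC qintD IH [qint _ n.+1]big_ord_recr /= -/(qint _ n).
by rewrite mulrDr -exprM [q ^+ _ * _]mulrC.
Qed.

Lemma qint_subXX (R : comNzRingType) (q : R) n : 1 - q ^+ n = (1 - q) * qint q n.
Proof. by rewrite -[1](expr1n R n) subrXX expr1n; congr (_ * _); apply: eq_bigr => i _; rewrite expr1n mul1r. Qed.

Lemma zq_unit p n : zq p n \is a GRing.unit.
Proof.
have hp := prime_gt0 (prime_valP p).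
suff : zq p n ^+ p \is a GRing.unit by rewrite unitrX_pos.
apply: (@nilp_unit _ _ ((1 - zq p n) * qint (zq p n) p) n.+1).
  by rewrite exprMn zp_nilp mulr0.
by rewrite -qint_subXX addrC subrK unitr1.
Qed.

Lemma qint_unit (p : prime_nat) n m : (0 < m < p)%N -> qint (zq p n) m \is a GRing.unit.
Proof.
move=> /andP[m0 mp].
have /coprimeP cop : coprime m p.
  by rewrite coprime_sym prime_coprime ?prime_valP // gtnNdvd.
have [[u v] /= /eqP uv] := cop m0.
have {}uv : (m * u = 1 + p * v)%N.
  have le : (v * p <= u * m)%N by rewrite leqNgt; apply/negP => /ltnW; rewrite -subn_eq0 (eqP uv).
  by rewrite mulnC [(p * v)%N]mulnC -(eqP uv) subnK.
suff : qint (zq p n) (m * u) \is a GRing.unit by rewrite qintM unitrM => /andP[].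
apply: (@nilp_unit _ _ (- (zq p n * qint (zq p n ^+ p) v * qint (zq p n) p)) n.+1).
  by rewrite -mulNr exprMn zp_nilp mulr0.
rewrite uv qintD qintM expr1 [qint _ 1]big_ord1 expr0.
by rewrite [X in 1 + _ * X]mulrC mulrA addrK unitr1.
Qed.

(** * The rings Q_n *)

Definition zprod (n : nat) := dprod (fun p : prime_nat => zpn p n : comNzRingType).

HB.instance Definition _ n := GRing.ComNzRing.on (zprod n).

(* The direct sum of the Z_{p,n+1} over the primes p.                          *)
Definition zsum (n : nat) : {pred zprod n} :=
  fun x => `[< finite_set [set p | x p != 0]%classic >].

Lemma zsumP n (x : zprod n) :
  (x \in @zsum n) <->
    exists N : nat, forall p : prime_nat, (N < p)%N -> x p = 0.
Proof.
split=> [/asboolP/finite_seqP[s sE]|[N hN]].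
  exists (\max_(p <- s) (p : nat))%N => p; apply: contraTeq => xp.
  rewrite -leqNgt; have ps : p \in s.
    have : [set r : prime_nat | x r != 0]%classic p by [].
    by rewrite sE.
  by rewrite (big_rem p ps) /= leq_maxl.
apply/asboolP; apply: (sub_finite_set (B := (prime_val @^-1` `I_N.+1)%classic)).
  by move=> p /= xp; rewrite ltnS leqNgt; apply/negP => /hN x0; rewrite x0 eqxx in xp.
by apply: finite_preimage; [move=> p q _ _; exact: val_inj | exact: finite_II].
Qed.

Fact zsum_idealr_closed n : idealr_closed (@zsum n).
Proof.
split=> [||a x y].
- by apply/zsumP; exists 0%N.
- apply/negP => /zsumP[N hN]; have [q Nq qp] := prime_above N.
  by have /eqP := hN (PrimeNat qp) Nq; rewrite (oner_eq0 (zpn _ _)).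
- move=> /zsumP[N hN] /zsumP[M hM]; apply/zsumP; exists (maxn N M) => p.
  rewrite gtn_max => /andP[/hN xp /hM yp].
  by rewrite [LHS]dprodD dprodM xp yp mulr0 addr0.
Qed.

HB.instance Definition _ n := isIdealr.Build (zprod n) (@zsum n) (@zsum_idealr_closed n).

(* [Qn n] is Q_{n+1}, by the index shift in [zpn].                            *)
Definition Qn (n : nat) := {ideal_quot @zsum n}.

HB.instance Definition _ n := GRing.ComNzRing.on (Qn n).

Definition to_Qn n (x : zprod n) : Qn n := (\pi_(Qn n) x)%qT.

Fact to_Qn_is_zmod_morphism n : zmod_morphism (@to_Qn n).
Proof. exact: pi_is_zmod_morphism. Qed.
Fact to_Qn_is_monoid_morphism n : monoid_morphism (@to_Qn n).
Proof. exact: pi_is_monoid_morphism. Qed.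
HB.instance Definition _ n := GRing.isZmodMorphism.Build (zprod n) (Qn n) (@to_Qn n)
  (@to_Qn_is_zmod_morphism n).
HB.instance Definition _ n := GRing.isMonoidMorphism.Build (zprod n) (Qn n) (@to_Qn n)
  (@to_Qn_is_monoid_morphism n).

Lemma to_QnP n (x y : zprod n) :
  to_Qn x = to_Qn y <->
    exists N : nat, forall p : prime_nat, (N < p)%N -> x p = y p.
Proof.
have -> : (to_Qn x = to_Qn y) <-> (x - y \in @zsum n).
  by rewrite Quotient.idealrBE; split=> /eqP.
have xyE p : (x - y) p = x p - y p by [].
rewrite zsumP; split=> -[N hN]; exists N => p /hN.
  by move=> /eqP; rewrite xyE subr_eq0 => /eqP.
by rewrite xyE => ->; rewrite subrr.
Qed.

Lemma to_Qn_repr n (x : Qn n) : to_Qn (repr x)%qT = x.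
Proof. exact: reprK. Qed.

(** * The ring Q hat *)

Definition zprod_redn n (x : zprod n.+1) : zprod n := fun p => redn (x p).

Definition Qn_redn n (x : Qn n.+1) : Qn n := to_Qn (zprod_redn (repr x)%qT).

Fact zprod_redn_is_zmod_morphism n : zmod_morphism (@zprod_redn n).
Proof. by move=> x y; apply: dprodP => p; apply: redn_is_zmod_morphism. Qed.
Fact zprod_redn_is_monoid_morphism n : monoid_morphism (@zprod_redn n).
Proof.
split=> [|x y]; apply: dprodP => p.
  exact: (redn_is_monoid_morphism p n).1.
exact: (redn_is_monoid_morphism p n).2.
Qed.
HB.instance Definition _ n :=
  GRing.isZmodMorphism.Build (zprod n.+1) (zprod n) (@zprod_redn n)
    (@zprod_redn_is_zmod_morphism n).
HB.instance Definition _ n :=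
  GRing.isMonoidMorphism.Build (zprod n.+1) (zprod n) (@zprod_redn n)
    (@zprod_redn_is_monoid_morphism n).

Fact zprod_redn_zsum n (x : zprod n.+1) : x \in @zsum n.+1 -> zprod_redn x \in @zsum n.
Proof.
move=> /zsumP[N hN]; apply/zsumP; exists N => p /hN xp.
by rewrite /zprod_redn xp (rmorph0 (@redn p n)).
Qed.

Lemma Qn_redn_to_Qn n (x : zprod n.+1) : Qn_redn (to_Qn x) = to_Qn (zprod_redn x).
Proof. exact: (quot_map_pi (@zprod_redn_zsum n)). Qed.

Fact Qn_redn_is_zmod_morphism n : zmod_morphism (@Qn_redn n).
Proof. exact: (quot_map_is_zmod_morphism (@zprod_redn_zsum n)). Qed.
Fact Qn_redn_is_monoid_morphism n : monoid_morphism (@Qn_redn n).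
Proof. exact: (quot_map_is_monoid_morphism (@zprod_redn_zsum n)). Qed.
HB.instance Definition _ n := GRing.isZmodMorphism.Build (Qn n.+1) (Qn n) (@Qn_redn n)
  (@Qn_redn_is_zmod_morphism n).
HB.instance Definition _ n := GRing.isMonoidMorphism.Build (Qn n.+1) (Qn n) (@Qn_redn n)
  (@Qn_redn_is_monoid_morphism n).

Definition Qprod := dprod (fun n : nat => Qn n : comNzRingType).
HB.instance Definition _ := GRing.ComNzRing.on Qprod.

Definition Qhat_pred : {pred Qprod} :=
  fun x => `[< forall n, Qn_redn (x n.+1) = x n >].

Fact Qhat_subring_closed : subring_closed Qhat_pred.
Proof.
split=> [|x y /asboolP hx /asboolP hy|x y /asboolP hx /asboolP hy]; apply/asboolP => n.
- exact: rmorph1.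
- by rewrite [LHS]Qn_redn_is_zmod_morphism hx hy.
- apply: etrans ((Qn_redn_is_monoid_morphism n).2 (x n.+1) (y n.+1)) _.
  by rewrite hx hy.
Qed.

HB.instance Definition _ :=
  GRing.isSubringClosed.Build Qprod Qhat_pred Qhat_subring_closed.

Record Qhat := QHat { Qhat_val :> Qprod; _ : Qhat_val \in Qhat_pred }.

HB.instance Definition _ := [isSub of Qhat for Qhat_val].
HB.instance Definition _ := [Choice of Qhat by <:].
HB.instance Definition _ := [SubChoice_isSubComNzRing of Qhat by <:].
HB.instance Definition _ := GRing.ComNzRing_hasMulInverse.Build Qhat
  (@cmulVx Qhat) (@cunitPl Qhat) (@cinv_out Qhat).

(* The element ((f p n)_p)_n of Q hat, for a family f of elements of the       *)
(* Z_{p,n} compatible with reduction.                                          *)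
Section OfFamily.
Context (f : forall (p : prime_nat) (n : nat), zpn p n)
        (hf : forall p n, redn (f p n.+1) = f p n).

Definition Qhat_family : Qprod := fun n => to_Qn (fun p => f p n).

Fact Qhat_family_subproof : Qhat_family \in Qhat_pred.
Proof.
apply/asboolP => n; rewrite /Qhat_family Qn_redn_to_Qn.
by congr to_Qn; apply: dprodP => p; apply: hf.
Qed.

Definition of_family : Qhat := QHat Qhat_family_subproof.
End OfFamily.

Lemma QhatP (x y : Qhat) : (forall n, val x n = val y n) -> x = y.
Proof. by move=> xy; apply/val_inj/dprodP. Qed.

Lemma of_familyP f g hf hg :
  (forall n, exists N : nat, forall p : prime_nat, (N < p)%N -> f p n = g p n) ->
  @of_family f hf = @of_family g hg.
Proof. by move=> fg; apply: QhatP => n; apply/to_QnP/fg. Qed.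

Lemma qharm_rmorph (rel : rel nat) (R S : comUnitRingType) (f : {rmorphism R -> S})
    (q : R) m ks :
  (forall j, (0 < j <= m)%N -> qint q j \is a GRing.unit) ->
  f (qharm rel q m ks) = qharm rel (f q) m ks.
Proof.
move=> qU; rewrite rmorph_sum; apply: eq_bigr => ms /andP[_ /allP ms0].
rewrite rmorph_prod; apply: eq_bigr => a _.
rewrite rmorphM rmorphV ?rmorphXn ?qint_rmorph // unitrX //; apply: qU.
have -> /= : (0 < tnth ms a)%N by apply/ms0/map_f/mem_tnth.
by rewrite -ltnS.
Qed.

Fact redn_qharm (rel : rel nat) (p : prime_nat) n ks :
  redn (qharm rel (zq p n.+1) p.-1 ks) = qharm rel (zq p n) p.-1 ks.
Proof.
apply: etrans (qharm_rmorph rel (@redn p n) ks _) _; last first.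
  exact: (congr1 (fun x => qharm rel x p.-1 ks) (redn_zq p n)).
move=> j /andP[j0 jp]; apply: qint_unit.
by rewrite j0 /= -[X in (_ < X)%N](prednK (prime_gt0 (prime_valP p))).
Qed.

Definition Qzeta (ks : seq nat) : Qhat :=
  of_family (f := fun p n => qH (zq p n) p.-1 ks) (fun p n => redn_qharm gtn p n ks).
Definition Qzeta_star (ks : seq nat) : Qhat :=
  of_family (f := fun p n => qHstar (zq p n) p.-1 ks) (fun p n => redn_qharm geq p n ks).

(* q, [p] and q^(-p).                                                          *)
Definition Qq : Qhat := of_family redn_zq.

Fact redn_qint p n : redn (qint (zq p n.+1) p) = qint (zq p n) p.
Proof.
apply: etrans (qint_rmorph (@redn p n) _ _) _.
exact: (congr1 (fun x => qint x p) (redn_zq p n)).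
Qed.
Definition Qp : Qhat := of_family redn_qint.

Fact redn_qVp p n : redn ((zq p n.+1 ^+ p)^-1) = (zq p n ^+ p)^-1.
Proof.
apply: etrans (rmorphV (@redn p n) _) _; first by rewrite unitrX // zq_unit.
congr (_^-1); apply: etrans (rmorphXn (@redn p n) _ _) _.
exact: (congr1 (fun x => x ^+ p) (redn_zq p n)).
Qed.
Definition QqVp : Qhat := of_family redn_qVp.

Definition Qhat_proj (n : nat) (x : Qhat) : Qn n := val x n.

Fact Qhat_proj_is_zmod_morphism n : zmod_morphism (@Qhat_proj n).
Proof. by []. Qed.
Fact Qhat_proj_is_monoid_morphism n : monoid_morphism (@Qhat_proj n).
Proof. by []. Qed.
HB.instance Definition _ n := GRing.isZmodMorphism.Build Qhat (Qn n) (@Qhat_proj n)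
  (@Qhat_proj_is_zmod_morphism n).
HB.instance Definition _ n := GRing.isMonoidMorphism.Build Qhat (Qn n) (@Qhat_proj n)
  (@Qhat_proj_is_monoid_morphism n).

Lemma Qhat_proj_redn n (x : Qhat) : Qn_redn (Qhat_proj n.+1 x) = Qhat_proj n x.
Proof. by case: x => x /= xP; have /asboolP/(_ n) := xP. Qed.

Lemma Qhat_projP (x y : Qhat) : (forall n, Qhat_proj n x = Qhat_proj n y) -> x = y.
Proof. exact: QhatP. Qed.

Lemma Qhat_proj_family n f hf :
  Qhat_proj n (@of_family f hf) = to_Qn (fun p : prime_nat => f p n).
Proof. by []. Qed.

(** ** The structure of Q-algebra *)

Lemma zloc_pred_prime (p : nat) (a : rat) :
  prime p -> (`|denq a| < p)%N -> a \in zloc_pred p.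
Proof.
move=> pp ap; rewrite unfold_in /zloc_pred prime_coprime // gtnNdvd //.
by rewrite absz_gt0 denq_neq0.
Qed.

(* The image of a rational in Z_(p), or 0 if p divides its denominator.        *)
Definition zloc_of_rat (p : nat) (a : rat) : zloc p := insubd (0 : zloc p) a.

Lemma zloc_of_ratK (p : nat) (a : rat) :
  a \in zloc_pred p -> val (zloc_of_rat p a) = a.
Proof. by move=> ap; rewrite val_insubd ap. Qed.

Fact redn_rat (a : rat) (p : prime_nat) n :
  redn (to_zpn n.+1 (zloc_of_rat p a)%:P) = to_zpn n (zloc_of_rat p a)%:P.
Proof. exact: redn_to_zpn. Qed.

Definition Qhat_of_rat (a : rat) : Qhat := of_family (redn_rat a).

Fact Qhat_of_rat1 : Qhat_of_rat 1 = 1.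
Proof.
apply: Qhat_projP => n; rewrite Qhat_proj_family rmorph1 -(rmorph1 (@to_Qn n)).
apply/to_QnP; exists 1%N => p p1.
have -> : zloc_of_rat p 1 = 1.
  by apply: val_inj; rewrite zloc_of_ratK // zloc_pred_prime ?prime_valP.
exact: (rmorph1 (@to_zpn p n)).
Qed.

Fact Qhat_of_ratM a b : Qhat_of_rat (a * b) = Qhat_of_rat a * Qhat_of_rat b.
Proof.
apply: Qhat_projP => n; rewrite rmorphM !Qhat_proj_family -(rmorphM (@to_Qn n)).
apply/to_QnP; exists (maxn `|denq a| `|denq b|)%N => p.
rewrite gtn_max => /andP[pa pb].
have {}pa := zloc_pred_prime (prime_valP p) pa.
have {}pb := zloc_pred_prime (prime_valP p) pb.
have -> : zloc_of_rat p (a * b) = zloc_of_rat p a * zloc_of_rat p b.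
  apply: val_inj; rewrite [LHS]zloc_of_ratK ?rpredM //.
  by rewrite -[in LHS](zloc_of_ratK pa) -[in LHS](zloc_of_ratK pb).
by rewrite polyCM; apply: (rmorphM (@to_zpn p n)).
Qed.

Fact Qhat_of_ratD a b : Qhat_of_rat (a + b) = Qhat_of_rat a + Qhat_of_rat b.
Proof.
apply: Qhat_projP => n; rewrite rmorphD !Qhat_proj_family -(rmorphD (@to_Qn n)).
apply/to_QnP; exists (maxn `|denq a| `|denq b|)%N => p.
rewrite gtn_max => /andP[pa pb].
have {}pa := zloc_pred_prime (prime_valP p) pa.
have {}pb := zloc_pred_prime (prime_valP p) pb.
have -> : zloc_of_rat p (a + b) = zloc_of_rat p a + zloc_of_rat p b.
  apply: val_inj; rewrite [LHS]zloc_of_ratK ?rpredD //.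
  by rewrite -[in LHS](zloc_of_ratK pa) -[in LHS](zloc_of_ratK pb).
by rewrite polyCD; apply: (rmorphD (@to_zpn p n)).
Qed.

Definition Qhat_scale (a : rat) (x : Qhat) : Qhat := Qhat_of_rat a * x.

Fact Qhat_scaleA a b x : Qhat_scale a (Qhat_scale b x) = Qhat_scale (a * b) x.
Proof. by rewrite /Qhat_scale Qhat_of_ratM mulrA. Qed.
Fact Qhat_scale1 : left_id 1 Qhat_scale.
Proof. by move=> x; rewrite /Qhat_scale Qhat_of_rat1 mul1r. Qed.
Fact Qhat_scaleDr : right_distributive Qhat_scale +%R.
Proof. by move=> a x y; rewrite /Qhat_scale mulrDr. Qed.
Fact Qhat_scaleDl x : {morph Qhat_scale^~ x : a b / a + b}.
Proof. by move=> a b; rewrite /Qhat_scale Qhat_of_ratD mulrDl. Qed.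
Fact Qhat_scaleAl (a : rat) (x y : Qhat) : Qhat_scale a (x * y) = Qhat_scale a x * y.
Proof. by rewrite /Qhat_scale mulrA. Qed.

HB.instance Definition _ := GRing.Zmodule_isLmodule.Build rat Qhat
  Qhat_scaleA Qhat_scale1 Qhat_scaleDr Qhat_scaleDl.
HB.instance Definition _ := GRing.Lmodule_isLalgebra.Build rat Qhat Qhat_scaleAl.
HB.instance Definition _ := GRing.Lalgebra_isComAlgebra.Build rat Qhat.

(** ** The [p]-adic topology *)

Lemma Qp_nilp n : Qhat_proj n Qp ^+ n.+1 = 0.
Proof.
rewrite Qhat_proj_family -rmorphXn -(rmorph0 (@to_Qn n)); congr to_Qn.
apply: dprodP => p; rewrite -[RHS](zp_nilp p n).
by elim: n.+1 => // m IH; rewrite !exprS -IH.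
Qed.

Lemma Qp_nil n m : (n < m)%N -> Qhat_proj n Qp ^+ m = 0.
Proof. by move=> /subnKC <-; rewrite exprD Qp_nilp mul0r. Qed.

Lemma Qhat_adic_sum_uniq (a : nat -> Qhat) (s t : Qhat) :
  is_adic_sum Qp a s -> is_adic_sum Qp a t -> s = t.
Proof.
move=> hs ht; apply: Qhat_projP => n.
have [M hM] := hs n.+1; have [N hN] := ht n.+1.
have [z sz] := hM _ (leq_maxl M N); have [w tw] := hN _ (leq_maxr M N).
have : s - t = Qp ^+ n.+1 * (z - w) by rewrite mulrBr -sz -tw opprB addrA subrK.
move=> /(congr1 (Qhat_proj n)); rewrite rmorphM rmorphXn Qp_nilp mul0r rmorphB.
by move=> /eqP; rewrite subr_eq0 => /eqP.
Qed.

Section AdicSum.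
Context (b : nat -> Qhat).

Definition adic_limit_seq : Qprod :=
  fun n => Qhat_proj n (\sum_(l < n.+1) Qp ^+ l * b l).

Fact adic_limit_subproof : adic_limit_seq \in Qhat_pred.
Proof.
apply/asboolP => n; rewrite /adic_limit_seq Qhat_proj_redn big_ord_recr /=.
by rewrite rmorphD rmorphM rmorphXn Qp_nilp mul0r addr0.
Qed.

Definition adic_limit : Qhat := QHat adic_limit_subproof.

Lemma adic_limit_proj n :
  Qhat_proj n adic_limit = Qhat_proj n (\sum_(l < n.+1) Qp ^+ l * b l).
Proof. by []. Qed.
End AdicSum.

Lemma adic_limitS b m :
  adic_limit b = \sum_(l < m) Qp ^+ l * b l + Qp ^+ m * adic_limit (fun l => b (m + l)%N).
Proof.
apply: Qhat_projP => n.
rewrite rmorphD rmorphM /= !adic_limit_proj.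
rewrite -(rmorphM (@Qhat_proj n)) -(rmorphD (@Qhat_proj n)) mulr_sumr.
transitivity (Qhat_proj n (\sum_(l < n.+1 + m) Qp ^+ l * b l)); last first.
  rewrite addnC big_split_ord; congr (Qhat_proj n (_ + _)).
  by apply: eq_bigr => l _; rewrite mulrA exprD.
rewrite [X in _ = Qhat_proj n X]big_split_ord /= [RHS]rmorphD [X in _ + X]rmorph_sum.
rewrite [X in _ + X]big1 ?addr0 // => l _.
by rewrite rmorphM rmorphXn Qp_nil ?mul0r // leq_addr.
Qed.

(* In particular the series of the [p]^l b_l always converges.                 *)
Lemma Qhat_adic_sumP b : is_adic_sum Qp (fun l => Qp ^+ l * b l) (adic_limit b).
Proof.
move=> N; exists N => m /subnKC <-.
exists (Qp ^+ (m - N) * adic_limit (fun l => b (N + (m - N) + l)%N)).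
by rewrite [in LHS](adic_limitS b (N + (m - N))) addrAC subrr add0r exprD mulrA.
Qed.

Lemma Qhat_adic_sumE b : adic_sum Qp (fun l => Qp ^+ l * b l) = adic_limit b.
Proof.
apply: xget_unique; first exact: Qhat_adic_sumP.
by move=> s hs; apply: Qhat_adic_sum_uniq hs (Qhat_adic_sumP b).
Qed.

(** * Cyclic orbits of indices *)

(* The indices of weight k and depth d. Their entries are at most k, so that   *)
(* 'I_k.+1 makes this type finite without loss of generality.                  *)
Definition is_wd_index (k d : nat) (t : d.-tuple 'I_k.+1) : bool :=
  all (ltn 0) (map val t) && (sumn (map val t) == k).

Record wd_index (k d : nat) := WdIndex {
  wd_tuple : d.-tuple 'I_k.+1;
  _ : is_wd_index wd_tuple
}.

HB.instance Definition _ k d := [isSub of wd_index k d for @wd_tuple k d].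
HB.instance Definition _ k d := [Finite of wd_index k d by <:].

Coercion wd_seq k d (x : wd_index k d) : seq nat := map val (wd_tuple x).

Fact cyc_subproof k d (x : wd_index k d) : is_wd_index [tuple of rot 1 (wd_tuple x)].
Proof.
case: x => t; rewrite /is_wd_index /= map_rot => /andP[t0 tk].
have rt : perm_eq (rot 1 (map val t)) (map val t) by rewrite perm_rot.
by rewrite (perm_all _ rt) t0 (perm_sumn rt).
Qed.

(* (k_1, ..., k_d) |-> (k_2, ..., k_d, k_1) *)
Definition cyc k d (x : wd_index k d) : wd_index k d := WdIndex (cyc_subproof x).

Fact cyc_inj k d : injective (@cyc k d).
Proof. by move=> x y /(congr1 (val \o val)) /= /rot_inj /val_inj /val_inj. Qed.

Definition cyc_perm k d : {perm wd_index k d} := perm (@cyc_inj k d).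

Definition cyclic_orbits (k d : nat) : {set {set wd_index k d}} := porbits (cyc_perm k d).

(* Main.v *)
(* Write w_k(x) = q^((k-1)x)/[x]^k and v(x) = q^x/[x]. Partial fractions give,
   for 0 < m < a,
     sum_{s=0}^{k-2} w_{k-s}(a) w_{s+1}(m)
       = w_k(m) (1/[a-m] - 1/[a]) - w_k(a) v(a-m).
   Multiply by the weights of a chain between a and m and sum over a < p. The
   first term telescopes into sums over j of v(x-j), where x is the first entry
   of the chain of the rotated index, minus sums of v(p-j). So the left-hand side
   for an index is T(rotated index) - T(index), for an explicit kernel sum T, plus
   terms in v(p-j); the T's cancel over a cyclic orbit. The terms in v(p-j) are
   the adic sums: as [m] - q^(m-p) [p] = - q^(m-p) [p-m], a geometric series gives
     sum_l (q^(-p) [p])^l w_{l+1}(m) = - v(p-m).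
   In the star case the terms with a = m moreover give products of powers of v(x)
   and 1/[x], which 1/[x] = v(x) + (1-q) expands into weights w_j(x). All this is
   exact in Z_{p,n} for every p and n.                                           *)

Require Import Defs.
From mathcomp Require Import all_boot all_order all_algebra all_fingroup.
From mathcomp Require Import zify ring.

Set Implicit Arguments.
Unset Strict Implicit.
Unset Printing Implicit Defensive.

Import GRing.Theory.
Local Open Scope ring_scope.

(** * Chain sums *)

Lemma sum_tuple_cons (V : nmodType) (T : finType) n (C : pred (n.+1.-tuple T))
    (F : n.+1.-tuple T -> V) :
  \sum_(t | C t) F t
  = \sum_(x : T) \sum_(t : n.-tuple T | C [tuple of x :: t]) F [tuple of x :: t].
Proof.
rewrite pair_big_dep /=.
rewrite (reindex (fun z : T * n.-tuple T => [tuple of z.1 :: z.2])) //=.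
exists (fun t => (thead t, [tuple of behead t])) => [[x t]|t] _ /=.
  by rewrite theadE; congr pair; apply: val_inj.
by rewrite [RHS]tuple_eta; apply: val_inj.
Qed.

(** Order conditions are kept as 0/1 factors over the fixed range [1, N[, so that double sums can be
    exchanged freely. *)
Lemma sum_nat_delta (R : pzSemiRingType) (N m : nat) (F : nat -> R) :
  (0 < m < N)%N -> \sum_(1 <= x < N) (x == m)%:R * F x = F m.
Proof.
move=> mN; rewrite (bigD1_seq m) ?iota_uniq ?mem_index_iota //= eqxx mul1r.
by rewrite big1 ?addr0 // => x /negPf ->; rewrite mul0r.
Qed.

Section HarmonicSums.
Context (R : comUnitRingType) (q : R) (M : nat) (rel : rel nat).
Let N := M.+1.

Definition qweight (k x : nat) : R := q ^+ ((k - 1) * x) / qint q x ^+ k.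
Definition qfrac (x : nat) : R := q ^+ x / qint q x.

Local Notation w := qweight.
Local Notation v := qfrac.

(* Sum over the [rel]-chains x = x_0, x_1, ..., x_r = m with entries in [1, N[; *)
(* the entry x_i carries the weight of the i-th index, x_0 none.               *)
Fixpoint chain_sum (ks : seq nat) (x m : nat) : R :=
  if ks is k :: ks' then
    \sum_(1 <= y < N) (rel x y)%:R * (w k y * chain_sum ks' y m)
  else (x == m)%:R.

Local Notation Q := chain_sum.

Fixpoint below_sum (ks : seq nat) (x : nat) : R :=
  if ks is k :: ks' then
    \sum_(1 <= y < N) (rel x y)%:R * (w k y * below_sum ks' y)
  else 1.

Lemma below_sumE ks x : (0 < x < N)%N ->
  below_sum ks x = \sum_(1 <= m < N) Q ks x m.
Proof.
elim: ks x => [|k ks IH] x xN /=.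
  under eq_bigr => m _ do rewrite -[(x == m)%:R]mulr1 [x == m]eq_sym.
  by rewrite (sum_nat_delta (fun=> 1)).
rewrite exchange_big_nat; apply: eq_big_nat => y yN.
by rewrite IH // !mulr_sumr.
Qed.

Lemma below_sum_tuple ks b :
  \sum_(ms : (size ks).-tuple 'I_N |
        path rel b (map val ms) && all (ltn 0) (map val ms))
    \prod_(a < size ks) w (nth 0%N ks a) (tnth ms a) = below_sum ks b.
Proof.
elim: ks b => [|k ks IH] b /=.
  rewrite (big_pred1 [tuple]) ?big_ord0 // => t; rewrite [t]tuple0 /= eqxx.
  by [].
rewrite sum_tuple_cons big_geq_mkord [RHS]big_mkcond /=; apply: eq_bigr => x _.
have [x0|] := boolP (0 < x)%N; last first.
  rewrite -leqNgt leqn0 => /eqP x0; rewrite big_pred0 // => t.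
  by rewrite /= x0 andbF.
have [bx|_] := boolP (rel b x); last first.
  by rewrite mul0r big_pred0 // => t; rewrite /=.
rewrite mul1r -IH mulr_sumr; apply: eq_big => [t|t _]; rewrite /= ?bx ?x0 //.
rewrite big_ord_recl /=; congr (_ * _); apply: eq_bigr => a _.
by rewrite tnthS.
Qed.

Lemma qharm_cons k ks :
  qharm rel q M (k :: ks) = \sum_(1 <= x < N) w k x * \sum_(1 <= m < N) Q ks x m.
Proof.
transitivity (\sum_(1 <= x < N) w k x * below_sum ks x); last first.
  by apply: eq_big_nat => x xN; rewrite below_sumE.
rewrite /qharm sum_tuple_cons big_geq_mkord [RHS]big_mkcond /=.
apply: eq_bigr => x _.
have [x0|] := boolP (0 < x)%N; last first.
  rewrite -leqNgt leqn0 => /eqP x0; rewrite big_pred0 // => t.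
  by rewrite /= x0 andbF.
rewrite -below_sum_tuple mulr_sumr; apply: eq_big => [t|t _]; rewrite /= ?x0 //.
rewrite big_ord_recl /=; congr (_ * _); apply: eq_bigr => a _.
by rewrite tnthS.
Qed.

(** The definition peels off the first index; rotating an index needs the last one too. *)
Lemma chain_sum_rcons ks k x m : (0 < x < N)%N -> (0 < m < N)%N ->
  Q (rcons ks k) x m = (\sum_(1 <= y < N) Q ks x y * (rel y m)%:R) * w k m.
Proof.
move=> + mN; elim: ks x => [|h ks IH] x xN /=.
  under eq_bigr => y _ do rewrite mulrA mulrC.
  rewrite (sum_nat_delta (fun y => (rel x y)%:R * w k y) mN); congr (_ * _).
  under eq_bigr => y _ do rewrite eq_sym.
  by rewrite (sum_nat_delta (fun y => (rel y m)%:R)).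
under [in RHS]eq_bigr => y _ do rewrite mulr_suml.
rewrite exchange_big_nat mulr_suml; apply: eq_big_nat => y yN.
rewrite IH // !mulr_suml !mulr_sumr; apply: eq_bigr => z _.
by rewrite !mulrA.
Qed.

(* The part of the harmonic sum of [rcons ks k] lying above its last entry m.  *)
Definition above_sum (ks : seq nat) (m : nat) : R :=
  if ks is k :: ks' then
    \sum_(1 <= x < N) w k x * \sum_(1 <= y < N) Q ks' x y * (rel y m)%:R
  else 1.

(** A factor depending only on the last entry m sees the chain from below; the weight at m can then
    be changed. *)
Lemma chain_sum_last ks k h t F : rcons ks k = h :: t ->
  \sum_(1 <= x < N) \sum_(1 <= m < N) w h x * Q t x m * F m
  = \sum_(1 <= m < N) above_sum ks m * w k m * F m.
Proof.
rewrite exchange_big_nat => kst; apply: eq_big_nat => m mN.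
rewrite -mulr_suml; congr (_ * _); case: ks kst => [[<- <-]|h' ks [<- <-]] /=.
  under eq_bigr => x _ do rewrite mulrC.
  by rewrite (sum_nat_delta (w k)) // mul1r.
by rewrite mulr_suml; apply: eq_big_nat => x xN; rewrite chain_sum_rcons // mulrA.
Qed.

Lemma qharm_rcons ks k :
  qharm rel q M (rcons ks k) = \sum_(1 <= m < N) above_sum ks m * w k m.
Proof.
case kst : (rcons ks k) => [|h t]; first by case: ks kst.
rewrite qharm_cons -[RHS](eq_bigr _ (fun m _ => mulr1 _)).
rewrite -(chain_sum_last (fun=> 1) kst); apply: eq_bigr => x _.
by rewrite mulr_sumr; apply: eq_bigr => m _; rewrite mulr1.
Qed.

Lemma qharm_cons_rcons k ks k' :
  qharm rel q M (k :: rcons ks k') = \sum_(1 <= x < N) \sum_(1 <= m < N)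
    (\sum_(1 <= y < N) Q ks x y * (rel y m)%:R) * (w k x * w k' m).
Proof.
rewrite qharm_cons; apply: eq_big_nat => x xN; rewrite mulr_sumr.
by apply: eq_big_nat => m mN; rewrite chain_sum_rcons // mulrCA.
Qed.

End HarmonicSums.

(** * Partial fractions and telescoping *)

Section QCalculus.
Context (R : comUnitRingType) (q : R) (M : nat).
Let N := M.+1.
Hypothesis qintU : forall j, (0 < j < N)%N -> qint q j \is a GRing.unit.

Local Notation w := (qweight q).
Local Notation v := (qfrac q).
Local Notation br := (qint q).

Lemma qint_inv x : (0 < x < N)%N -> (br x)^-1 = v x + (1 - q).
Proof.
move=> xN; apply: (mulIr (qintU xN)); rewrite mulVr ?qintU // mulrDl divrK ?qintU //.
by rewrite -qint_subXX addrC subrK.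
Qed.

Lemma qweightS k x : w k.+1 x = v x ^+ k / br x.
Proof.
by rewrite /qweight subn1 exprMn -exprM mulnC exprVn -mulrA -!exprVn -exprSr.
Qed.

Lemma qweightD k l x : (0 < k)%N -> w (k + l) x = w k x * v x ^+ l.
Proof. by case: k => // k _; rewrite addSn !qweightS exprD mulrAC. Qed.

(** One factor 1/[m] of the product is expanded as v(m) + (1-q); this produces the sum with
    prefactor 1-q in the non-star formula. *)
Lemma qweight_merge k l m : (0 < k)%N -> (0 < m < N)%N ->
  w (k + l + 1) m + (1 - q) * w (k + l) m = w k m * w l.+1 m.
Proof.
move=> k0 mN; rewrite -addnA !qweightD // addn1 qweightS qint_inv // exprSr; ring.
Qed.

Lemma qint_split m a : (m <= a)%N -> br a = br (a - m) + q ^+ (a - m) * br m.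
Proof. by move=> ma; rewrite -{1}(subnK ma) qintD. Qed.

(** Divide [a] = [a-m] + q^(a-m) [m] by [a] [m] [a-m]. *)
Lemma inv_qint_mul m a : (0 < m < a)%N -> (a < N)%N ->
  (br a)^-1 / br m = ((br m)^-1 - q ^+ (a - m) / br a) / br (a - m).
Proof.
move=> /andP[m0 ma] aN.
have mU : br m \is a GRing.unit by apply: qintU; lia.
have aU : br a \is a GRing.unit by apply: qintU; lia.
have dU : br (a - m) \is a GRing.unit by apply: qintU; lia.
have E : (br m)^-1 / br (a - m)
       = (br m)^-1 / br (a - m) * ((br (a - m) + q ^+ (a - m) * br m) / br a).
  by rewrite -qint_split ?(ltnW ma) // divrr // mulr1.
rewrite mulrBl E; have := mulVr mU; have := mulVr dU.
set A := (br a)^-1; set B := (br m)^-1; set D := (br (a - m))^-1 => D1 B1.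
transitivity (A * B * (D * br (a - m)) + q ^+ (a - m) * A * D * (B * br m)
              - q ^+ (a - m) * A * D); last by ring.
by rewrite D1 B1; ring.
Qed.

(* Partial fractions in [m] and [a - m], iterated on the exponent of [a].      *)
Lemma qweight_convolution k m a : (0 < k)%N -> (0 < m < a)%N -> (a < N)%N ->
  \sum_(0 <= s < k.-1) w (k - s) a * w s.+1 m
  = w k m * ((br (a - m))^-1 - (br a)^-1) - w k a * v (a - m).
Proof.
case: k => // n _ ma aN; have mul := inv_qint_mul ma aN.
rewrite big_mkord /=; elim: n => [|n IH].
  rewrite big_ord0 !qweightS /qfrac !expr0 !mul1r.
  transitivity ((br a)^-1 / br m - (br a)^-1 / br m); first by rewrite subrr.
  by rewrite {1}mul; ring.
(* Apart from s = 0, shifting s multiplies each term of the shorter sum by v(m). *)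
rewrite big_ord_recl subn0 /=.
under eq_bigr => s _ do
  rewrite /bump /= add1n subSS -[s.+2]addn1 qweightD // expr1 mulrA.
rewrite -mulr_suml IH !qweightS !exprSr.
have ema : v a = q ^+ m * q ^+ (a - m) / br a by rewrite -exprD subnKC //; lia.
(* Partial fractions multiplied by q^a. *)
suff E : v a / br m = v (a - m) * (v m - v a).
  transitivity (v a ^+ n / br a * (v a / br m)
     + (v m ^+ n / br m * ((br (a - m))^-1 - (br a)^-1)
       - v a ^+ n / br a * v (a - m)) * v m); first by ring.
  by rewrite E; ring.
rewrite ema -mulrA mul /qfrac; ring.
Qed.

(** In 1/[y] = v(y) + (1-q) the constants cancel; passing from m to m+1 then adds a telescoping sum
    with end terms v(x-m) and -v(N-m-1). *)
Lemma qint_inv_telescope x m : (m <= x)%N -> (x < N)%N ->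
  \sum_(x.+1 <= a < N) ((br (a - m))^-1 - (br a)^-1)
  = \sum_(0 <= j < m) v (x - j) - \sum_(1 <= j < m.+1) v (N - j).
Proof.
move=> mx xN.
transitivity (\sum_(x.+1 <= a < N) (v (a - m) - v a)).
  apply: eq_big_nat => a /andP[xa aN].
  by rewrite !qint_inv; [ring | lia | lia].
elim: m mx => [_|m IH mx].
  by rewrite !big_nil subr0 big1 // => a _; rewrite subn0 subrr.
rewrite [\sum_(0 <= j < m.+1) _]big_nat_recr // [\sum_(1 <= j < m.+2) _]big_nat_recr //=.
transitivity (\sum_(x.+1 <= a < N) (- v (a.+1 - m.+1) - - v (a - m.+1))
              + \sum_(x.+1 <= a < N) (v (a - m) - v a)).
  by rewrite -big_split; apply: eq_bigr => a _; rewrite subSS /=; ring.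
rewrite (telescope_sumr (fun a => - v (a - m.+1))) // IH 1?ltnW // subSS /=; ring.
Qed.

(** The telescoped term j = 0 is v(x), set apart because it raises the exponent of the first entry
    by one. *)
Lemma qint_inv_sum_gtn x m : (0 < m <= x)%N -> (x < N)%N ->
  \sum_(1 <= a < N) (a > x)%:R * ((m < a)%:R * ((br (a - m))^-1 - (br a)^-1))
  = v x + \sum_(1 <= j < N) (m > j)%:R * ((j < x)%:R * v (x - j))
    - \sum_(1 <= j < m.+1) v (N - j).
Proof.
move=> /andP[m0 mx] xN; rewrite (big_cat_nat (n := x.+1)) //=.
rewrite big_nat big1 ?add0r => [|a ax]; last first.
  have -> : (x < a)%N = false by lia.
  by rewrite mul0r.
transitivity (\sum_(x.+1 <= a < N) ((br (a - m))^-1 - (br a)^-1)).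
  apply: eq_big_nat => a /andP[xa _].
  by rewrite xa (leq_ltn_trans mx xa) !mul1r.
rewrite qint_inv_telescope // [\sum_(0 <= j < m) _]big_ltn // subn0.
congr (_ + _ - _); rewrite [RHS](big_cat_nat (n := m)) //=; last by lia.
rewrite [X in _ + X]big_nat [X in _ + X]big1 ?addr0 => [|a /andP[ma _]].
  by apply: eq_big_nat => j /andP[_ jm]; rewrite jm (leq_trans jm mx) !mul1r.
by rewrite ltnNge ma mul0r.
Qed.

(** For m < x the range a >= x starts one lower than in the strict case, so the telescoped terms are
    v(x-j) with 1 <= j <= m. For x = m the factor m < a excludes a = x, and the strict case
    applies. *)
Lemma qint_inv_sum_geq x m : (0 < m <= x)%N -> (x < N)%N ->
  \sum_(1 <= a < N) (a >= x)%:R * ((m < a)%:R * ((br (a - m))^-1 - (br a)^-1))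
  = (x == m)%:R * v x + \sum_(1 <= j < N) (m >= j)%:R * ((j < x)%:R * v (x - j))
    - \sum_(1 <= j < m.+1) v (N - j).
Proof.
move=> mx xN; have [<-|xm] := eqVneq x m.
  rewrite mul1r -[RHS]/(_ + _ - _).
  have -> : \sum_(1 <= j < N) (x >= j)%:R * ((j < x)%:R * v (x - j))
          = \sum_(1 <= j < N) (x > j)%:R * ((j < x)%:R * v (x - j)).
    by apply: eq_bigr => j _; case: ltngtP; rewrite ?mul0r ?mulr0.
  rewrite -qint_inv_sum_gtn; [|lia|lia].
  by apply: eq_bigr => a _; case: ltngtP; rewrite ?mul0r ?mulr0.
have {xm} mx' : (0 < m < x)%N by lia.
rewrite mul0r add0r; case: x xN mx' {mx} => [|x] xN mx; first by case/andP: mx.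
have -> : \sum_(1 <= j < N) (m >= j)%:R * ((j < x.+1)%:R * v (x.+1 - j))
        = \sum_(0 <= j < m) v (x - j).
  rewrite (big_cat_nat (n := m.+1)) //=; last by lia.
  rewrite [X in _ + X]big_nat [X in _ + X]big1 ?addr0 => [|j jm]; last first.
    have -> : (j <= m)%N = false by lia.
    by rewrite mul0r.
  rewrite big_add1 /=; apply: eq_big_nat => j jm.
  have [-> ->] : (j < m)%N /\ (j.+1 < x.+1)%N by lia.
  by rewrite !mul1r subSS.
rewrite -qint_inv_telescope; [|lia|lia].
rewrite (big_cat_nat (n := x.+1)) //=; last by lia.
rewrite big_nat big1 ?add0r => [|a ax]; last first.
  have -> : (x < a)%N = false by lia.
  by rewrite mul0r.
apply: eq_big_nat => a /andP[xa aN]; rewrite xa mul1r.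
have -> : (m < a)%N by lia.
by rewrite mul1r.
Qed.

(* Since [m] - q^(m-N) [N] = - q^(m-N) [N-m], a geometric series in            *)
(* q^(-N) [N] moves the pole from m to N - m.                                  *)
Lemma qweight_geometric n m : q \is a GRing.unit -> br N ^+ n.+1 = 0 ->
  (0 < m < N)%N ->
  \sum_(l < n.+1) ((q ^+ N)^-1 * br N) ^+ l * w l.+1 m = - v (N - m).
Proof.
move=> qU nil mN; set z := (q ^+ N)^-1 * br N.
have dU : br (N - m) \is a GRing.unit by apply: qintU; lia.
(* Nilpotency of [N] makes the truncated geometric series an exact inverse. *)
have geo : (1 - z * v m) * \sum_(l < n.+1) (z * v m) ^+ l = 1.
  by rewrite -opprB mulNr -subrX1 mulrAC exprMn nil mulr0 sub0r opprK.
apply: (mulIr dU); rewrite mulNr /qfrac divrK //.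
under eq_bigr => l _ do rewrite qweightS mulrA -exprMn.
rewrite -mulr_suml; set s := (\sum_(l < _) _) in geo *.
have mN' : (m <= N)%N by lia.
have zE : q ^+ (N - m) * (z * q ^+ m) = br N.
  by rewrite mulrCA -exprD subnK // /z mulrAC mulVr ?unitrX // mul1r.
have -> : br (N - m) = - (q ^+ (N - m) * (br m * (1 - z * v m))).
  rewrite mulrBr mulr1 (mulrCA _ z) /qfrac (mulrC (br m)) divrK ?qintU //.
  by rewrite mulrBr zE opprB (qint_split mN') addrK.
rewrite mulrN; congr (- _).
transitivity (q ^+ (N - m) * ((1 - z * v m) * s) * ((br m)^-1 * br m)); first by ring.
by rewrite geo mulVr ?qintU // !mulr1.
Qed.
End QCalculus.

(** * The identity for one index and its rotation *)

Section CyclicStep.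
Context (R : comUnitRingType) (q : R) (M : nat) (rel : rel nat).
Let N := M.+1.
Hypothesis qintU : forall j, (0 < j < N)%N -> qint q j \is a GRing.unit.
Hypothesis rel_geq : forall x y, rel x y -> (y <= x)%N.

Local Notation w := (qweight q).
Local Notation v := (qfrac q).
Local Notation br := (qint q).
Local Notation Q := (chain_sum q M rel).

Lemma chain_sum_eq0 ks x m : (x < m)%N -> Q ks x m = 0.
Proof.
elim: ks x => [|k ks IH] x xm /=; first by rewrite ltn_eqF.
rewrite big1 // => y _; case: (boolP (rel x y)) => [/rel_geq yx|_].
  by rewrite IH ?mulr0 // (leq_ltn_trans yx).
by rewrite mul0r.
Qed.

Definition below_kernel (x m : nat) : R :=
  \sum_(1 <= j < N) (rel m j)%:R * ((j < x)%:R * v (x - j)).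

(** The sum T to be cancelled over orbits: the entry j of the kernel extends the chain below m. *)
Definition kernel_sum k ks : R :=
  \sum_(1 <= x < N) \sum_(1 <= m < N) w k x * Q ks x m * below_kernel x m.

(** With j renamed as the last entry, T matches the terms w_k(a) v(a-m) of the partial fractions. *)
Lemma kernel_sumE k ks : kernel_sum k ks = \sum_(1 <= x < N) \sum_(1 <= m < N)
  (\sum_(1 <= y < N) Q ks x y * (rel y m)%:R) * ((m < x)%:R * (w k x * v (x - m))).
Proof.
apply: eq_bigr => x _; under eq_bigr => m _ do rewrite mulr_sumr.
rewrite exchange_big_nat; apply: eq_bigr => m _; rewrite mulr_suml.
by apply: eq_bigr => y _; ring.
Qed.

(** Terms whose first and last entries coincide; strict chains have none. *)
Definition diag_sum k ks : R := \sum_(1 <= x < N)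
  (\sum_(1 <= y < N) Q ks x y * (rel y x)%:R)
  * \sum_(0 <= s < k.-1) w (k - s) x * w s.+1 x.

(** The coefficient of v(x) depends on the relation: 1 for [gtn], the indicator of x = m for
    [geq]. *)
Variable c : nat -> nat -> R.
Hypothesis qint_inv_sum : forall x m, (0 < m <= x)%N -> (x < N)%N ->
  \sum_(1 <= a < N) (rel a x)%:R * ((m < a)%:R * ((br (a - m))^-1 - (br a)^-1))
  = c x m * v x + below_kernel x m - \sum_(1 <= j < m.+1) v (N - j).

(* The terms with m < x of the left-hand side are summed over x first.         *)
Lemma cyclic_step k ks h t : (0 < k)%N -> rcons ks k = h :: t ->
  \sum_(0 <= s < k.-1) qharm rel q M ((k - s)%N :: rcons ks s.+1) + kernel_sum k ks
  = diag_sum k ks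
    + \sum_(1 <= x < N) \sum_(1 <= m < N) w h x * Q t x m * (c x m * v x)
    + kernel_sum h t
    - \sum_(1 <= x < N) \sum_(1 <= m < N)
        w h x * Q t x m * \sum_(1 <= j < m.+1) v (N - j).
Proof.
move=> k0 kst; pose Z x m : R := \sum_(1 <= y < N) Q ks x y * (rel y m)%:R.
pose G x m : R := (m < x)%:R * ((br (x - m))^-1 - (br x)^-1).
transitivity (diag_sum k ks
   + \sum_(1 <= x < N) \sum_(1 <= m < N) Z x m * w k m * G x m).
  rewrite kernel_sumE.
  under eq_bigr => s _ do rewrite qharm_cons_rcons.
  rewrite exchange_big_nat -!big_split; apply: eq_big_nat => x xN /=.
  rewrite exchange_big_nat -big_split /=.
  rewrite -[Z' in _ = Z' * _ + _]/(Z x x).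
  (* The diagonal is written as a delta in m, so that both sides are compared for each pair (x,
     m). *)
  rewrite -(sum_nat_delta
    (fun m => Z x m * \sum_(0 <= s < k.-1) w (k - s) x * w s.+1 m) xN).
  rewrite -big_split /=; apply: eq_big_nat => m mN.
  rewrite -mulr_sumr -![(\sum_(1 <= _ < N) _) in LHS]/(Z x m).
  case: (ltngtP m x) => [mx|xm|->]; last first.
  - by rewrite /G ltnn !(mul0r, mulr0, mul1r, addr0).
  - suff -> : Z x m = 0 by rewrite !(mul0r, mulr0, addr0).
    rewrite /Z big1 // => y _; case: (boolP (rel y m)) => [/rel_geq my|_].
      by rewrite chain_sum_eq0 ?mul0r // (leq_trans xm).
    by rewrite mulr0.
  - rewrite (qweight_convolution (M := M)) //; [|lia|lia].
    by rewrite /G mx !mul1r mul0r; ring.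
rewrite -!addrA; congr (_ + _).
(* With w_k(m) absorbed, the chain belongs to [rcons ks k], the rotated index, and x keeps no weight
   of its own. *)
transitivity (\sum_(1 <= x < N) \sum_(1 <= m < N) Q (rcons ks k) x m * G x m).
  apply: eq_big_nat => x xN; apply: eq_big_nat => m mN.
  by rewrite chain_sum_rcons.
rewrite kst /=.
transitivity (\sum_(1 <= y < N) \sum_(1 <= m < N)
    w h y * Q t y m * \sum_(1 <= x < N) (rel x y)%:R * G x m).
  under eq_bigr => x _ do (under eq_bigr => m _ do rewrite mulr_suml;
    rewrite exchange_big_nat /=).
  rewrite exchange_big_nat; apply: eq_bigr => y _ /=.
  rewrite exchange_big_nat; apply: eq_bigr => m _ /=.
  by rewrite mulr_sumr; apply: eq_bigr => x _; ring.
rewrite /kernel_sum -sumrN -!big_split; apply: eq_big_nat => x xN /=.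
rewrite -sumrN -!big_split; apply: eq_big_nat => m mN /=.
have [mx|xm] := leqP m x; last first.
  by rewrite chain_sum_eq0 // !(mulr0, mul0r, oppr0, addr0).
by rewrite /G qint_inv_sum //; [ring | lia | lia].
Qed.

(** Only the weight of the last entry j involves l, so the sum over l replaces it by - v(N-j). *)
Lemma qharm_geometric n k ks h t : q \is a GRing.unit -> br N ^+ n.+1 = 0 ->
  rcons ks k = h :: t ->
  \sum_(l < n.+1) ((q ^+ N)^-1 * br N) ^+ l * qharm rel q M (rcons (rcons ks k) l.+1)
  = - \sum_(1 <= x < N) \sum_(1 <= m < N) w h x * Q t x m *
      \sum_(1 <= j < N) (rel m j)%:R * v (N - j).
Proof.
move=> qU nil ->.
under eq_bigr => l _ do rewrite rcons_cons qharm_cons_rcons mulr_sumr.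
rewrite exchange_big /= -sumrN; apply: eq_bigr => x _.
under eq_bigr => l _ do rewrite mulr_sumr.
rewrite exchange_big /= -sumrN.
transitivity (\sum_(1 <= j < N) \sum_(1 <= y < N)
   - (w h x * Q t x y * ((rel y j)%:R * v (N - j)))).
  apply: eq_big_nat => j jN.
  transitivity (- v (N - j) * (w h x * (\sum_(1 <= y < N) Q t x y * (rel y j)%:R))).
    rewrite -(qweight_geometric qintU qU nil jN) mulr_suml.
    by apply: eq_bigr => l _; ring.
  by rewrite !mulr_sumr; apply: eq_bigr => y _; ring.
rewrite exchange_big_nat; apply: eq_bigr => y _ /=.
by rewrite mulr_sumr sumrN.
Qed.
End CyclicStep.

(** * The non-star formula for a single index *)

Section FiniteCyclicSums.
Context (R : comUnitRingType) (q : R) (M : nat).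
Hypothesis qU : q \is a GRing.unit.
Hypothesis qintU : forall j, (0 < j < M.+1)%N -> qint q j \is a GRing.unit.

Local Notation w := (qweight q).
Local Notation v := (qfrac q).
Local Notation Q := (chain_sum q M).

Definition cyclic_kernel (rel : rel nat) (s : seq nat) : R :=
  kernel_sum q M rel (head 0%N s) (behead s).

Lemma rot1_cons (T : Type) (k : T) s : rot 1 (k :: s) = rcons s k.
Proof. by rewrite /rot /= drop0 take0 cats1. Qed.

(** The series in l stops at n because [N]^(n+1) = 0. Up to the kernel sums and a rotation in the
    first term on the right, this is the formula before summation over the orbit. *)
Lemma qH_cyclic n N s : N = M.+1 -> qint q N ^+ n.+1 = 0 ->
  (0 < size s)%N -> all (ltn 0) s ->
  \sum_(0 <= i < (head 0%N s).-1)
     qH q M ((head 0 s - i)%N :: behead s ++ [:: i.+1]) + cyclic_kernel gtn s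
  = qH q M ((head 0 (rot 1 s) + 1)%N :: behead (rot 1 s))
    + \sum_(l < n.+1) ((q ^+ N)^-1 * qint q N) ^+ l *
        (qH q M (behead s ++ [:: head 0 s; l + 1])%N
         + qH q M (behead s ++ [:: head 0 s + l + 1])%N)
    + (1 - q) * \sum_(l < n.+1) ((q ^+ N)^-1 * qint q N) ^+ l *
        qH q M (behead s ++ [:: head 0 s + l])%N
    + cyclic_kernel gtn (rot 1 s).
Proof.
move=> -> nil; case: s => // k ks _ /= /andP[k0 ks0]; rewrite rot1_cons.
have : all (ltn 0) (rcons ks k) by rewrite all_rcons; apply/andP.
case kst : (rcons ks k) => [|h t] /=; first by case: (ks) kst.
move=> /andP[h0 _].
under eq_bigr => s _ do rewrite cats1.
have gtn_geq : forall x y : nat, (y < x)%N -> (y <= x)%N by move=> x y /ltnW.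
have inner x m (mx : (0 < m <= x)%N) (xM : (x < M.+1)%N) :
    \sum_(1 <= a < M.+1) (a > x)%:R * ((m < a)%:R *
      ((qint q (a - m))^-1 - (qint q a)^-1))
    = 1 * v x + below_kernel q M gtn x m - \sum_(1 <= j < m.+1) v (M.+1 - j).
  by rewrite mul1r qint_inv_sum_gtn.
rewrite /cyclic_kernel /=.
rewrite (cyclic_step qintU (rel := gtn) gtn_geq (c := fun _ _ => 1) inner k0 kst).
have -> : diag_sum q M gtn k ks = 0.
  rewrite /diag_sum big1 // => x _; rewrite big1 ?mul0r // => y _.
  have [xy|yx] := ltnP x y; last by rewrite /= ltnNge yx mulr0.
  by rewrite chain_sum_eq0 ?mul0r.
rewrite add0r.
have -> : qH q M ((h + 1)%N :: t)
   = \sum_(1 <= x < M.+1) \sum_(1 <= m < M.+1) w h x * Q gtn t x m * (1 * v x).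
  rewrite /qH qharm_cons; apply: eq_bigr => x _; rewrite mulr_sumr.
  by apply: eq_bigr => m _; rewrite qweightD // expr1 mul1r mulrAC.
rewrite -!addrA; congr (_ + _); rewrite addrC [in RHS]addrA; congr (_ + _).
have geo := qharm_geometric gtn qintU qU nil kst.
(* The sum over j <= m splits: the part j < m adds a strict last entry, the part j = m changes the
   weight at m. *)
transitivity (
  - (\sum_(1 <= x < M.+1) \sum_(1 <= m < M.+1) w h x * Q gtn t x m *
      \sum_(1 <= j < M.+1) (m > j)%:R * v (M.+1 - j))
  - \sum_(1 <= x < M.+1) \sum_(1 <= m < M.+1) w h x * Q gtn t x m * v (M.+1 - m)).
  rewrite -opprD -big_split; congr (- _); apply: eq_bigr => x _ /=.
  rewrite -big_split; apply: eq_big_nat => m mN /=.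
  rewrite -mulrDr; congr (_ * _); rewrite big_nat_recr ?(andP mN).1 //=.
  congr (_ + _); rewrite [RHS](big_cat_nat (n := m)) ?(andP mN).1 //=; last by lia.
  rewrite [X in _ + X]big_nat [X in _ + X]big1 ?addr0 => [|j /andP[mj _]].
    by apply: eq_big_nat => j /andP[_ jm]; rewrite jm mul1r.
  by rewrite ltnNge mj mul0r.
rewrite -geo (chain_sum_last q M gtn (fun m => v (M.+1 - m)) kst).
rewrite [(1 - q) * _]mulr_sumr -sumrN.
(* At j = m the geometric series puts w_(l+1)(m) beside w_k(m), and the two merge. *)
have -> : \sum_(1 <= m < M.+1) - (above_sum q M gtn ks m * w k m * v (M.+1 - m))
  = \sum_(l < n.+1) ((q ^+ M.+1)^-1 * qint q M.+1) ^+ l *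
      (qH q M (rcons ks (k + l + 1)) + (1 - q) * qH q M (rcons ks (k + l))).
  transitivity (\sum_(1 <= m < M.+1) \sum_(l < n.+1)
     above_sum q M gtn ks m * w k m *
      (((q ^+ M.+1)^-1 * qint q M.+1) ^+ l * w l.+1 m)).
    apply: eq_big_nat => m mN.
    by rewrite -mulr_sumr (qweight_geometric qintU qU nil mN) mulrN.
  rewrite exchange_big; apply: eq_bigr => l _ /=.
  rewrite /qH !qharm_rcons [(1 - q) * _]mulr_sumr -big_split [RHS]mulr_sumr.
  apply: eq_big_nat => m mN /=.
  transitivity (((q ^+ M.+1)^-1 * qint q M.+1) ^+ l * (above_sum q M gtn ks m *
     (w k m * w l.+1 m))); first by ring.
  by rewrite -(qweight_merge qintU) //; ring.
rewrite -!big_split; apply: eq_bigr => l _ /=.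
by rewrite !cats1 -cat_rcons cats1 addn1 /qH; ring.
Qed.
End FiniteCyclicSums.

(** * The star formula for a single index *)

Lemma size_leq_sumn s : all (ltn 0) s -> (size s <= sumn s)%N.
Proof. by elim: s => //= k s IH /andP[k0 /IH]; lia. Qed.

Section FiniteStarSums.
Context (R : comUnitRingType) (q : R) (M : nat).
Hypothesis qU : q \is a GRing.unit.
Hypothesis qintU : forall j, (0 < j < M.+1)%N -> qint q j \is a GRing.unit.

Local Notation w := (qweight q).
Local Notation v := (qfrac q).
Local Notation Q := (chain_sum q M).

(** A weakly decreasing chain from x to x is constant. *)
Lemma chain_sum_diag ks x : (0 < x < M.+1)%N ->
  Q geq ks x x = \prod_(k <- ks) w k x.
Proof.
move=> xN; elim: ks => [|k ks IH] /=; first by rewrite eqxx big_nil.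
rewrite big_cons -IH -(sum_nat_delta (fun y => w k y * Q geq ks y x) xN).
apply: eq_bigr => y _; case: (ltngtP y x) => // yx.
by rewrite chain_sum_eq0 // mulr0 !mulr0.
Qed.

Lemma prod_qweight ks x : all (ltn 0) ks ->
  \prod_(k <- ks) w k x = v x ^+ (sumn ks - size ks) / qint q x ^+ size ks.
Proof.
elim: ks => [|[|k] ks IH] //= ks0; first by rewrite big_nil expr0 mul1r invr1.
rewrite big_cons IH // qweightS addSn subSS -addnBA ?size_leq_sumn //.
by rewrite exprD -!exprVn [X in _ = _ * X]exprS; ring.
Qed.

Lemma qHstar1 k : qHstar q M [:: k] = \sum_(1 <= x < M.+1) w k x.
Proof.
rewrite /qHstar (qharm_rcons q M geq [::] k).
by apply: eq_bigr => x _; rewrite mul1r.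
Qed.

(* 1/[x] = q^x/[x] + (1 - q)                                                   *)
Lemma qHstar_binomial a b :
  \sum_(1 <= x < M.+1) v x ^+ a / qint q x ^+ b.+1
  = \sum_(j < b.+1) ((1 - q) ^+ j * qHstar q M [:: (a + b + 1 - j)%N]) *+ 'C(b, j).
Proof.
under [RHS]eq_bigr => j _ do rewrite qHstar1 mulr_sumr -sumrMnl.
rewrite exchange_big; apply: eq_big_nat => x xN /=.
rewrite -exprVn exprSr {1}(qint_inv qintU xN) exprDn mulr_suml mulr_sumr.
apply: eq_bigr => j _.
have -> : (a + b + 1 - j = (a + (b - j)).+1)%N by have := ltn_ord j; lia.
by rewrite qweightS exprD mulrnAl mulrnAr; congr (_ *+ _); ring.
Qed.

(** For s of weight k and depth d, the expansion of the sum over x of v(x)^(k-d) / [x]^(d+1). *)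
Definition star_diag (s : seq nat) : R :=
  \sum_(j < (size s).+1) ((1 - q) ^+ j * qHstar q M [:: (sumn s + 1 - j)%N])
     *+ 'C(size s, j).
(** The same for v(x)^(k-d+1) / [x]^d, which comes from the constant chains multiplied by v(x). *)
Definition star_edge (s : seq nat) : R :=
  \sum_(j < size s) ((1 - q) ^+ j * qHstar q M [:: (sumn s + 1 - j)%N])
     *+ 'C((size s).-1, j).

(** The sum over j <= m now matches the weak chains directly, so nothing is merged; the diagonal and
    the terms c(x,m) v(x) give the first two summands. *)
Lemma qHstar_cyclic n N s : N = M.+1 -> qint q N ^+ n.+1 = 0 ->
  (0 < size s)%N -> all (ltn 0) s ->
  \sum_(0 <= i < (head 0%N s).-1)
     qHstar q M ((head 0 s - i)%N :: behead s ++ [:: i.+1]) + cyclic_kernel q M geq s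
  = star_diag s *+ (head 0%N s).-1 + star_edge s
    + \sum_(l < n.+1) ((q ^+ N)^-1 * qint q N) ^+ l *
        qHstar q M (behead s ++ [:: head 0 s; l + 1])%N
    + cyclic_kernel q M geq (rot 1 s).
Proof.
move=> -> nil; case: s => // k ks _ s0; rewrite rot1_cons.
have prodE x : w k x * \prod_(i <- ks) w i x
    = v x ^+ (sumn (k :: ks) - size (k :: ks)) / qint q x ^+ (size ks).+1.
  by rewrite -(prod_qweight _ s0) big_cons.
have le_ks : (size (k :: ks) <= sumn (k :: ks))%N by apply: size_leq_sumn.
have /andP[k0 ks0] := s0.
have perm_ks : perm_eq (rcons ks k) (k :: ks) by rewrite perm_rcons.
case kst : (rcons ks k) perm_ks => [|h t] perm_ks; first by case: (ks) kst.
under eq_bigr => s _ do rewrite cats1.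
rewrite [X in _ = _ + _ + X + _](_ : _ = \sum_(l < n.+1)
   ((q ^+ M.+1)^-1 * qint q M.+1) ^+ l * qharm geq q M (rcons (rcons ks k) l.+1));
  last by apply: eq_bigr => l _; rewrite /= -cat_rcons cats1 addn1.
have geq_leq : forall x y : nat, geq x y -> (y <= x)%N by [].
rewrite /cyclic_kernel /=.
rewrite (cyclic_step qintU geq_leq (c := fun x m => (x == m)%:R)
  (qint_inv_sum_geq qintU) k0 kst).
rewrite (qharm_geometric geq qintU qU nil kst) addrAC.
congr (_ + _ + _); last first.
  apply: congr1; apply: eq_big_nat => x _; apply: eq_big_nat => m mN.
  congr (_ * _); rewrite [RHS](big_cat_nat (n := m.+1)) //=; last by lia.
  rewrite [X in _ + X]big_nat [X in _ + X]big1 ?addr0 => [|j jm]; last first.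
    have -> : (j <= m)%N = false by lia.
    by rewrite mul0r.
  apply: eq_big_nat => j jm.
  have -> : (j <= m)%N by lia.
  by rewrite mul1r.
congr (_ + _).
  rewrite /star_diag.
  have -> : (sumn (k :: ks) = (sumn (k :: ks) - size (k :: ks)) + size (k :: ks))%N.
    by rewrite subnK.
  rewrite -qHstar_binomial /diag_sum -sumrMnl; apply: eq_big_nat => x xN.
  rewrite [X in X * _](_ : _ = \prod_(i <- ks) w i x); last first.
    rewrite -(chain_sum_diag _ xN) -(sum_nat_delta (fun y => Q geq ks x y) xN).
    apply: eq_bigr => y _; rewrite mulrC; case: (ltngtP x y) => [xy|yx|->] /=.
    - by rewrite chain_sum_eq0 // !mulr0.
    - by rewrite leqNgt yx !mul0r.
    - by rewrite leqnn.
  (* w_(k-s)(x) w_(s+1)(x) = w_k(x) / [x] does not depend on s, whence the factor k - 1. *)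
  rewrite [X in _ * X](_ : _ = \sum_(0 <= s < k.-1) w k x / qint q x); last first.
    apply: eq_big_nat => s /andP[_ sk]; have -> : (k = (k - s - 1 + s).+1)%N by lia.
    rewrite !qweightS; have -> : ((k - s - 1 + s).+1 - s = (k - s - 1).+1)%N by lia.
    by rewrite qweightS exprD; ring.
  rewrite sumr_const_nat subn0 mulrnAr; congr (_ *+ _).
  transitivity (w k x * (\prod_(i <- ks) w i x) / qint q x); first by ring.
  by rewrite prodE -!exprVn [in RHS]exprSr mulrA.
rewrite /star_edge.
have eqs : (sumn (k :: ks) = (sumn (k :: ks) - size (k :: ks)).+1 + size ks)%N.
  by rewrite /= in le_ks *; lia.
rewrite eqs -[(size (k :: ks)).-1]/(size ks) -[size (k :: ks)]/((size ks).+1).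
rewrite -qHstar_binomial.
apply: eq_big_nat => x xN.
under eq_bigr => m _ do rewrite mulrCA eq_sym.
rewrite (sum_nat_delta (fun m => w h x * Q geq t x m * v x)) //.
(* The product over a constant chain is symmetric in the index, hence unchanged by the rotation. *)
have -> : w h x * Q geq t x x = w k x * \prod_(i <- ks) w i x.
  transitivity (\prod_(i <- h :: t) w i x); first by rewrite chain_sum_diag // big_cons.
  by rewrite (perm_big _ perm_ks) big_cons.
rewrite prodE.
by rewrite [v x ^+ _.+1]exprSr mulrAC.
Qed.

End FiniteStarSums.

(** * Cyclic orbits *)

Section CyclicOrbits.
Context (k d : nat).
Implicit Types x : wd_index k d.

Lemma wd_seq_cyc x : wd_seq (cyc x) = rot 1 (wd_seq x).
Proof. by rewrite /wd_seq /= map_rot. Qed.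

Lemma size_wd_seq x : size (wd_seq x) = d.
Proof. by rewrite size_map size_tuple. Qed.

Lemma wd_seq_pos x : all (ltn 0) (wd_seq x).
Proof. by case: x => t tP; case/andP: (tP). Qed.

Lemma sumn_wd_seq x : sumn (wd_seq x) = k.
Proof. by case: x => t tP; case/andP: (tP) => _ /eqP. Qed.

Variable alpha : {set wd_index k d}.
Hypothesis alphaP : alpha \in cyclic_orbits k d.

Lemma cyc_mem_orbit x : (cyc x \in alpha) = (x \in alpha).
Proof.
have /imsetP[y _ ->] := alphaP; rewrite -!eq_porbit_mem.
have -> : cyc x = (cyc_perm k d ^+ 1)%g x by rewrite permE.
by rewrite ![_ == porbit _ y]eq_sym porbit_perm.
Qed.

(** This makes the kernel sums cancel: an orbit is stable under the injective rotation. *)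
Lemma sum_cyc (V : nmodType) (F : wd_index k d -> V) :
  \sum_(ks in alpha) F (cyc ks) = \sum_(ks in alpha) F ks.
Proof.
rewrite [RHS](reindex_inj (@cyc_inj k d)); apply: eq_bigl => x.
by rewrite cyc_mem_orbit.
Qed.

(** By rotation every position has the same sum over the orbit, and the d positions together give
    the weight k of each index. *)
Lemma sum_head_orbit : (0 < d)%N ->
  (d * \sum_(ks in alpha) head 0 ks = k * #|alpha|)%N.
Proof.
move=> d0; transitivity (\sum_(i < d) \sum_(ks in alpha) nth 0 ks i)%N.
  transitivity (\sum_(i < d) \sum_(ks in alpha) head 0 ks)%N.
    by rewrite sum_nat_const card_ord.
  apply: eq_bigr => -[i id] _ /=.
  elim: i id => [|i IH] id; first by under [RHS]eq_bigr do rewrite nth0.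
  rewrite (IH (ltnW id)) -(@sum_cyc nat); apply: eq_bigr => x _.
  rewrite wd_seq_cyc; have := size_wd_seq x.
  case: (wd_seq x) => [|h t] /=; first by lia.
  by rewrite rot1_cons nth_rcons => e; case: ltnP => //; lia.
rewrite exchange_big [RHS]mulnC -sum_nat_const; apply: eq_bigr => x _ /=.
by rewrite -[RHS](sumn_wd_seq x) sumnE (big_nth 0%N) big_mkord size_wd_seq.
Qed.
End CyclicOrbits.

(** * Transfer to the ring Q hat *)

Section Represents.
Variable n : nat.

Lemma zprodP (f g : zprod n) : (forall p, f p = g p) -> f = g.
Proof. exact: boolp.functional_extensionality_dep. Qed.

(** The lift f is determined only up to finitely many primes; an identity in Q hat is proved by
    lifts agreeing at every prime, for each n. *)
Definition represents (x : Qhat) (f : zprod n) : Prop := Qhat_proj n x = to_Qn f.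

Lemma represents_eq x y f g : represents x f -> represents y g ->
  (forall p, f p = g p) -> Qhat_proj n x = Qhat_proj n y.
Proof. by move=> -> -> fg; congr to_Qn; apply: zprodP. Qed.

Lemma represents_family f hf : represents (@of_family f hf) (fun p => f p n).
Proof. exact: Qhat_proj_family. Qed.

Lemma represents1 : represents 1 (fun=> 1).
Proof. by rewrite /represents rmorph1 -(rmorph1 (@to_Qn n)). Qed.

Lemma represents0 : represents 0 (fun=> 0).
Proof. by rewrite /represents rmorph0 -(rmorph0 (@to_Qn n)). Qed.

Lemma representsD x y f g : represents x f -> represents y g ->
  represents (x + y) (fun p => f p + g p).
Proof.
by rewrite /represents rmorphD /= => -> ->; rewrite -(rmorphD (@to_Qn n)).
Qed.

Lemma representsN x f : represents x f -> represents (- x) (fun p => - f p).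
Proof. by rewrite /represents rmorphN /= => ->; rewrite -(rmorphN (@to_Qn n)). Qed.

Lemma representsM x y f g : represents x f -> represents y g ->
  represents (x * y) (fun p => f p * g p).
Proof.
by rewrite /represents rmorphM /= => -> ->; rewrite -(rmorphM (@to_Qn n)).
Qed.

Lemma represents_sum I (r : seq I) (P : pred I) (F : I -> Qhat) (f : I -> zprod n) :
  (forall i, P i -> represents (F i) (f i)) ->
  represents (\sum_(i <- r | P i) F i) (fun p => \sum_(i <- r | P i) f i p).
Proof.
move=> Ff; rewrite /represents rmorph_sum (eq_bigr _ Ff) -rmorph_sum; congr to_Qn.
apply: zprodP => p; elim: r => [|i r IH]; first by rewrite !big_nil.
by rewrite !big_cons; case: (P i) => //=; rewrite -IH.
Qed.

Lemma representsMn x f m : represents x f -> represents (x *+ m) (fun p => f p *+ m).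
Proof.
move=> xf; elim: m => [|m IH]; first by rewrite mulr0n; apply: represents0.
rewrite mulrS (_ : (fun p => _) = (fun p => f p + f p *+ m)); last first.
  by apply: zprodP => p; rewrite mulrS.
exact: representsD.
Qed.

Lemma representsX x f m : represents x f -> represents (x ^+ m) (fun p => f p ^+ m).
Proof.
move=> xf; elim: m => [|m IH]; first exact: represents1.
rewrite exprS (_ : (fun p => _) = (fun p => f p * f p ^+ m)); last first.
  by apply: zprodP => p; rewrite exprS.
exact: representsM.
Qed.

(** At level n the power [p]^(n+1) is 0, which truncates the series; the powers of q^(-p) are moved
    into the coefficients. *)
Lemma represents_adic_sum (a : nat -> Qhat) (f : nat -> zprod n) :
  (forall l, represents (a l) (f l)) ->
  represents (adic_sum Qp (fun l => (QqVp * Qp) ^+ l * a l))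
    (fun p => \sum_(l < n.+1)
       ((zq p n ^+ p)^-1 * qint (zq p n) p) ^+ l * f l p).
Proof.
move=> af; have -> : (fun l => (QqVp * Qp) ^+ l * a l)
    = (fun l => Qp ^+ l * (QqVp ^+ l * a l)).
  by apply: boolp.funext => l; rewrite exprMn [_ ^+ l * Qp ^+ l]mulrC mulrA.
rewrite Qhat_adic_sumE /represents adic_limit_proj.
rewrite (eq_bigr (fun l : 'I_n.+1 => (QqVp * Qp) ^+ l * a l)); last first.
  by move=> l _; rewrite exprMn [_ ^+ l * Qp ^+ l]mulrC mulrA.
apply: represents_sum => l _; apply: representsM (af l).
by apply/representsX/representsM; apply: represents_family.
Qed.
End Represents.

Lemma qint_zq_unit (p : prime_nat) n j : (0 < j < p.-1.+1)%N ->
  qint (zq p n) j \is a GRing.unit.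
Proof. by rewrite (prednK (prime_gt0 (prime_valP p))); apply: (@qint_unit p n j). Qed.

(** * Summation over an orbit *)

Section QhatCyclicSums.
Context (k d : nat) (alpha : {set wd_index k d}).
Hypothesis d_gt0 : (0 < d)%N.
Hypothesis alphaP : alpha \in cyclic_orbits k d.

Lemma Qzeta_cyclic_sum :
  \sum_(ks in alpha) \sum_(0 <= s < (head 0%N ks).-1)
      Qzeta ((head 0 ks - s)%N :: behead ks ++ [:: s.+1])
  = \sum_(ks in alpha) Qzeta ((head 0 ks + 1)%N :: behead ks)
    + \sum_(ks in alpha) adic_sum Qp (fun l : nat =>
        (QqVp * Qp) ^+ l *
        (Qzeta (behead ks ++ [:: head 0 ks; l + 1])%N
         + Qzeta (behead ks ++ [:: head 0 ks + l + 1])%N))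
    + (1 - Qq) * \sum_(ks in alpha) adic_sum Qp (fun l : nat =>
        (QqVp * Qp) ^+ l * Qzeta (behead ks ++ [:: head 0 ks + l])%N).
Proof.
apply: Qhat_projP => n; eapply represents_eq.
- apply: represents_sum => ks _; apply: represents_sum => s _.
  exact: represents_family.
- apply: representsD; first apply: representsD.
  + by apply: represents_sum => ks _; apply: represents_family.
  + apply: represents_sum => ks _; apply: represents_adic_sum => l.
    by apply: representsD; apply: represents_family.
  + apply: representsM.
      apply: representsD; first exact: represents1.
      by apply: representsN; apply: represents_family.
    apply: represents_sum => ks _; apply: represents_adic_sum => l.
    exact: represents_family.
move=> p /=; set q := zq p n.
have eN : (p : nat) = p.-1.+1 by rewrite (prednK (prime_gt0 (prime_valP p))).
have step (ks : wd_index k d) := qH_cyclic (zq_unit p n) (@qint_zq_unit p n) eN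
  (zp_nilp p n) (etrans (congr1 _ (size_wd_seq ks)) d_gt0) (wd_seq_pos ks).
pose K (ks : wd_index k d) := cyclic_kernel q p.-1 gtn ks.
(* Both sides receive the kernel sums, whose total is the same for the rotated indices. *)
apply: (addIr (\sum_(ks in alpha) K ks)); rewrite -big_split /=.
rewrite (eq_bigr _ (fun ks _ => step ks)) !big_split /= -mulr_sumr.
under [X in X + _ + _ + _]eq_bigr => ks _ do rewrite -wd_seq_cyc.
under [X in _ + X = _]eq_bigr => ks _ do rewrite -wd_seq_cyc.
rewrite (sum_cyc alphaP (fun ks => qH q p.-1 ((head 0 ks + 1)%N :: behead ks))).
by rewrite (sum_cyc alphaP K).
Qed.

Let H j : Qhat := (1 - Qq) ^+ j * Qzeta_star [:: (k + 1 - j)%N].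

(** The coefficients are still integers here; the rational ones come from the average of k_1 over
    the orbit. *)
Lemma Qzeta_star_cyclic_sum :
  \sum_(ks in alpha) \sum_(0 <= s < (head 0%N ks).-1)
      Qzeta_star ((head 0 ks - s)%N :: behead ks ++ [:: s.+1])
  = \sum_(ks in alpha) (\sum_(j < d.+1) H j *+ 'C(d, j)) *+ (head 0%N ks).-1
    + \sum_(ks in alpha) (\sum_(j < d) H j *+ 'C(d.-1, j))
    + \sum_(ks in alpha) adic_sum Qp (fun l : nat =>
         (QqVp * Qp) ^+ l * Qzeta_star (behead ks ++ [:: head 0 ks; l + 1])%N).
Proof.
have reprH (n j : nat) : represents (n := n) (H j) (fun p =>
    (1 - zq p n) ^+ j * qHstar (zq p n) p.-1 [:: (k + 1 - j)%N]).
  apply: representsM; last exact: represents_family.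
  apply: representsX; apply: representsD; first exact: represents1.
  by apply: representsN; apply: represents_family.
apply: Qhat_projP => n; eapply represents_eq.
- apply: represents_sum => ks _; apply: represents_sum => s _.
  exact: represents_family.
- apply: representsD; first apply: representsD.
  + apply: represents_sum => ks _; apply: representsMn; apply: represents_sum => j _.
    by apply: representsMn; apply: reprH.
  + apply: represents_sum => ks _; apply: represents_sum => j _.
    by apply: representsMn; apply: reprH.
  + apply: represents_sum => ks _; apply: represents_adic_sum => l.
    exact: represents_family.
move=> p /=; set q := zq p n.
have eN : (p : nat) = p.-1.+1 by rewrite (prednK (prime_gt0 (prime_valP p))).
have step (ks : wd_index k d) := qHstar_cyclic (zq_unit p n) (@qint_zq_unit p n) eN
  (zp_nilp p n) (etrans (congr1 _ (size_wd_seq ks)) d_gt0) (wd_seq_pos ks).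
pose K (ks : wd_index k d) := cyclic_kernel q p.-1 geq ks.
apply: (addIr (\sum_(ks in alpha) K ks)); rewrite -big_split /=.
rewrite (eq_bigr _ (fun ks _ => step ks)) !big_split /=.
under [X in _ + X = _]eq_bigr => ks _ do rewrite -wd_seq_cyc.
rewrite (sum_cyc alphaP K); congr (_ + _ + _ + _); apply: eq_bigr => ks _.
  by rewrite /star_diag size_wd_seq sumn_wd_seq.
by rewrite /star_edge size_wd_seq sumn_wd_seq.
Qed.

End QhatCyclicSums.

(* Pascal's rule and j C(d, j) = d C(d-1, j-1) turn s C(d, j) + a C(d-1, j),   *)
(* with s + a = k a / d, into a (k/j - 1) C(d-1, j-1).                         *)
Lemma cyclic_coefficients (a k d s : nat) (V : lmodType rat) (H : nat -> V) :
  (0 < d)%N -> (d * (s + a) = k * a)%N ->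
  (\sum_(j < d.+1) H j *+ 'C(d, j)) *+ s + (\sum_(j < d) H j *+ 'C(d.-1, j)) *+ a
  = (k%:R / d%:R * a%:R : rat) *: H 0%N
    + (a%:R : rat) *: (\sum_(1 <= j < d.+1)
        ((k%:R / j%:R - 1) * 'C(d.-1, j.-1)%:R : rat) *: H j).
Proof.
case: d => // d _ /(congr1 (fun n => n%:R : rat)); rewrite !natrM natrD => E.
have d0 : (d.+1%:R : rat) != 0 by rewrite Num.Theory.pnatr_eq0.
have {}E : s%:R = k%:R * a%:R / d.+1%:R - a%:R :> rat.
  by rewrite -E mulrAC divff // mul1r addrK.
transitivity (\sum_(0 <= j < d.+2)
   ((s%:R * 'C(d.+1, j)%:R + a%:R * 'C(d, j)%:R : rat) *: H j)).
  under [RHS]eq_bigr do rewrite scalerDl -!scalerA.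
  rewrite big_split /= -!scaler_sumr !scaler_nat; congr (_ *+ _ + _ *+ _).
    by rewrite big_mkord; apply: eq_bigr => j _; rewrite scaler_nat.
  rewrite big_nat_recr //= bin_small // scale0r addr0 big_mkord.
  by apply: eq_bigr => j _; rewrite scaler_nat.
rewrite big_ltn // !bin0 scaler_sumr; congr (_ *: _ + _).
  by rewrite !mulr1 E subrK mulrAC.
apply: eq_big_nat => -[|j] // _; rewrite scalerA; congr (_ *: _) => /=.
have j0 : (j.+1%:R : rat) != 0 by rewrite Num.Theory.pnatr_eq0.
have B : ('C(d, j)%:R : rat) = j.+1%:R * 'C(d.+1, j.+1)%:R / d.+1%:R.
  by rewrite -natrM -mul_bin_diag natrM mulrAC divff ?mul1r.
have P : ('C(d, j.+1)%:R : rat) = 'C(d.+1, j.+1)%:R - 'C(d, j)%:R.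
  by rewrite binS natrD addrK.
rewrite P B E; move: d0 j0.
move: (d.+1%:R : rat) (j.+1%:R : rat) ('C(d.+1, j.+1)%:R : rat) => D J c D0 J0.
by field; rewrite J0 D0.
Qed.

(** The binomial coefficient in the star formula is C(d-1, j-1), as [cyclic_coefficients] computes
    it; the sentence at the head has C(d, j), which differs by the factor d/j. *)
Theorem theorem5p7 (k d : nat) (alpha : {set wd_index k d})
    (hd : (1 <= d)%N) (hk : (d <= k)%N) (halpha : alpha \in cyclic_orbits k d) :
  (\sum_(ks in alpha) \sum_(0 <= s < (head 0%N ks).-1)
      Qzeta ((head 0 ks - s)%N :: behead ks ++ [:: s.+1])
   = \sum_(ks in alpha) Qzeta ((head 0 ks + 1)%N :: behead ks)
     + \sum_(ks in alpha) adic_sum Qp (fun l : nat =>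
         (QqVp * Qp) ^+ l *
         (Qzeta (behead ks ++ [:: head 0 ks; l + 1])%N
          + Qzeta (behead ks ++ [:: head 0 ks + l + 1])%N))
     + (1 - Qq) * \sum_(ks in alpha) adic_sum Qp (fun l : nat =>
         (QqVp * Qp) ^+ l * Qzeta (behead ks ++ [:: head 0 ks + l])%N))
  /\
  (\sum_(ks in alpha) \sum_(0 <= s < (head 0%N ks).-1)
      Qzeta_star ((head 0 ks - s)%N :: behead ks ++ [:: s.+1])
   = (k%:R / d%:R * #|alpha|%:R : rat) *: Qzeta_star [:: (k + 1)%N]
     + (#|alpha|%:R : rat) *: (\sum_(1 <= j < d.+1)
         ((k%:R / j%:R - 1) * 'C(d.-1, j.-1)%:R : rat) *:
           ((1 - Qq) ^+ j * Qzeta_star [:: (k + 1 - j)%N]))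
     + \sum_(ks in alpha) adic_sum Qp (fun l : nat =>
         (QqVp * Qp) ^+ l * Qzeta_star (behead ks ++ [:: head 0 ks; l + 1])%N)).
Proof.
split; first exact: Qzeta_cyclic_sum.
rewrite Qzeta_star_cyclic_sum //; congr (_ + _).
rewrite sumrMnr sumr_const.
apply: etrans (@cyclic_coefficients _ k _ _ _ (fun j =>
  (1 - Qq) ^+ j * Qzeta_star [:: (k + 1 - j)%N]) hd _) _; last first.
  by rewrite expr0 mul1r subn0.
(* Here s is the sum of k_1 - 1 and s + |alpha| that of k_1, every k_1 being positive. *)
rewrite -(sum_head_orbit halpha hd) -sum1_card -big_split /=; congr (_ * _)%N.
apply: eq_bigr => ks _; have := wd_seq_pos ks; have := size_wd_seq ks.
by case: (wd_seq ks) => [|h t] /= => [|_ /andP[]]; lia.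
Qed.
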